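(* Let $n\ge 1$, let $X_{\Pi_n}$ be the $n$-dimensional permutohedral variety, and let $L_1,\dots,L_n\in \mathrm{CH}^1(X_{\Pi_n},\mathbb{Q})=\mathrm{Pic}(X_{\Pi_n},\mathbb{Q})$ be the hypersimplex divisor classes. (a) The divisors $L_1,\ldots,L_n$ span (generate) the invariant ring $\mathrm{CH}(X_{\Pi_n},\mathbb{Q})^{\mathfrak{S}_{n+1}}$ as a $\mathbb{Q}$-subalgebra of $\mathrm{CH}(X_{\Pi_n},\mathbb{Q})$. (b) The cone spanned by $L_1,\ldots,L_n$ inside the rational Picard group $\mathrm{Pic}(X_{\Pi_n},\mathbb{Q})$ is the intersection of the nef cone of $X_{\Pi_n}$ with the $\mathfrak{S}_{n+1}$-invariant part of the rational Picard group.
   Context: Write $[n]=\{0,1,\dots,n\}$. The permutohedron $\Pi_n\subset\mathbb{R}^{n+1}$ is the convex hull of all permutations of $(0,1,\dots,n)$, and $X_{\Pi_n}$ is the smooth projective toric variety (over $\mathbb{C}$) of its normal fan $\Sigma_n$ in $\mathbb{Z}^{n+1}/\langle(1,\dots,1)\rangle\otimes\mathbb{R}$. The rays of $\Sigma_n$ are generated by the classes $\overline{e_S}$ of $e_S=\sum_{i\in S}e_i$ for $\emptyset\subsetneq S\subsetneq[n]$; the rays indexed by $S_1,\dots,S_k$ span a cone iff the $S_i$ are pairwise comparable under inclusion. The rational Chow ring is $$\mathrm{CH}(X_{\Pi_n},\mathbb{Q})=\mathbb{Q}[x_S:\emptyset\subsetneq S\subsetneq[n]]/(I_l+I_q),$$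 where $I_q$ is generated by $x_{S}x_{T}$ for inclusion-incomparable $S,T$, and $I_l$ by $\sum_{S\ni a}x_S-\sum_{S\ni b}x_S$ for $a,b\in[n]$; $x_S$ is the class of the torus-invariant divisor of the ray $\overline{e_S}$. The symmetric group $\mathfrak{S}_{n+1}$ of permutations of $[n]$ acts by $\sigma\cdot x_S=x_{\sigma(S)}$. For $1\le i\le n$, $L_i=\sum_{\emptyset\subsetneq S\subsetneq[n]}c_{i,S}\,x_S$ where $c_{i,S}=\min(n+1-i,|S|)$ if $n\notin S$ and $c_{i,S}=\min(n+1-i,|S|)-(n+1-i)$ if $n\in S$. (The distinguished element $n$ may be replaced by any element of $[n]$ without changing the class.) The cone spanned by a set of vectors is the set of their nonnegative (rational) linear combinations. *)

(* Defs.v *)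
From HB Require Import structures.
From mathcomp Require Import all_boot all_order all_algebra all_fingroup all_field.
From mathcomp Require Import ring_quotient fraction.
From mathcomp Require Import boolp classical_sets functions cardinality fsbigop.
From mathcomp Require Import reals complex.
From mathcomp.multinomials Require Import mpoly.

Set Implicit Arguments.
Unset Strict Implicit.
Unset Printing Implicit Defensive.

Import GRing.Theory Num.Theory.

Local Open Scope ring_scope.
Local Open Scope quotient_scope.
Local Open Scope classical_set_scope.

(* The ground set [n] = {0, .., n} is 'I_n.+1, and the distinguished element n
   is ord_max. *)

Section GeneratedObjects.

Definition ideal_span (A : comNzRingType) (G : set A) : set A :=
  [set p | exists s : seq (A * A),
     (forall u, u \in s -> G u.2) /\ p = \sum_(u <- s) u.1 * u.2].

Definition subalgebra_span (A : lalgType rat) (G : set A) : set A :=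
  [set u | forall P : {pred A},
     GRing.subalg_closed P -> (forall g, G g -> g \in P) -> u \in P].

Definition conical_span (V : lmodType rat) (k : nat) (w : 'I_k -> V) : set V :=
  [set u | exists a : 'I_k -> rat,
     (forall i, 0 <= a i) /\ u = \sum_(i < k) a i *: w i].

End GeneratedObjects.

Section ChowRing.

Variable n : nat.

Definition proper_subset := {S : {set 'I_n.+1} | (0 < #|S| < n.+1)%N}.

Definition comparable_subsets (S T : proper_subset) : bool :=
  (val S \subset val T) || (val T \subset val S).

Definition chow_poly := {mpoly rat[#|{: proper_subset}|]}.

Definition subset_var (S : proper_subset) : chow_poly := 'X_(enum_rank S).

Definition incomparable_relations : set chow_poly :=
  [set p | exists S T, ~~ comparable_subsets S T /\
     p = subset_var S * subset_var T].

Definition linear_relations : set chow_poly :=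
  [set p | exists a b : 'I_n.+1,
     p = \sum_(S : proper_subset | a \in val S) subset_var S
         - \sum_(S : proper_subset | b \in val S) subset_var S].

Definition chow_ideal : {pred chow_poly} :=
  fun p => `[< ideal_span (linear_relations `|` incomparable_relations) p >].

Lemma chow_ideal_closed : idealr_closed chow_ideal.
Proof.
split.
- by apply/asboolP; exists [::]; rewrite big_nil.
- apply/asboolPn => -[s [sG]] /(congr1 (meval (fun=> 0))).
  rewrite mevalC raddf_sum /= big_seq big1 => [/eqP|u /sG uG].
    by rewrite oner_eq0.
  rewrite mevalM; case: uG => [[a [b ->]]|[S [T [_ ->]]]].
    by rewrite mevalB !(raddf_sum (meval (fun=> 0))) /= !big1 ?subr0 ?mulr0
      // => S _; exact: mevalXU.
  by rewrite mevalM [meval _ (subset_var S)]mevalXU mul0r mulr0.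
- move=> a u v /asboolP[s [sG ->]] /asboolP[t [tG ->]]; apply/asboolP.
  exists ([seq (a * w.1, w.2) | w <- s] ++ t); split=> [w|].
    rewrite mem_cat => /orP[/mapP[w' w's ->]|]; last exact: tG.
    exact: (sG _ w's).
  rewrite big_cat big_map mulr_sumr; congr (_ + _).
  by apply: eq_bigr => w _; rewrite mulrA.
Qed.

HB.instance Definition _ := isIdealr.Build chow_poly chow_ideal chow_ideal_closed.

Definition chow := {ideal_quot chow_ideal}.

HB.instance Definition _ := GRing.ComNzRing.on chow.
HB.instance Definition _ := NzRingQuotient.on chow.

Definition chow_scale (a : rat) (u : chow) : chow := \pi_chow (a%:MP) * u.

Lemma chow_scaleA a b u : chow_scale a (chow_scale b u) = chow_scale (a * b) u.
Proof. by rewrite /chow_scale mpolyCM rmorphM mulrA. Qed.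

Lemma chow_scale1 : left_id 1 chow_scale.
Proof. by move=> u; rewrite /chow_scale rmorph1 mul1r. Qed.

Lemma chow_scaleDr : right_distributive chow_scale +%R.
Proof. by move=> a u v; rewrite /chow_scale mulrDr. Qed.

Lemma chow_scaleDl u : {morph chow_scale^~ u : a b / a + b}.
Proof. by move=> a b; rewrite /chow_scale mpolyCD rmorphD mulrDl. Qed.

HB.instance Definition _ := GRing.Zmodule_isLmodule.Build rat chow
  chow_scaleA chow_scale1 chow_scaleDr chow_scaleDl.

Lemma chow_scaleAl (a : rat) (u v : chow) : a *: (u * v) = (a *: u) * v.
Proof. exact: mulrA. Qed.

HB.instance Definition _ := GRing.Lmodule_isLalgebra.Build rat chow chow_scaleAl.
HB.instance Definition _ := GRing.Lalgebra_isComAlgebra.Build rat chow.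

Definition chow_x (S : proper_subset) : chow := \pi_chow (subset_var S).

Definition divisor_class (c : proper_subset -> rat) : chow :=
  \sum_S c S *: chow_x S.

Definition Pic : set chow := range divisor_class.

Lemma perm_subset_subproof (s : {perm 'I_n.+1}) (S : proper_subset) :
  (0 < #|s @: val S| < n.+1)%N.
Proof. by rewrite card_imset; [exact: (valP S)|exact: perm_inj]. Qed.

Definition perm_subset (s : {perm 'I_n.+1}) (S : proper_subset) :
  proper_subset := exist _ (s @: val S) (perm_subset_subproof s S).

Definition perm_eval (s : {perm 'I_n.+1}) : chow_poly -> chow :=
  mmap (in_alg chow) (fun i => chow_x (perm_subset s (enum_val i))).

Definition chow_act (s : {perm 'I_n.+1}) (u : chow) : chow :=
  perm_eval s (generic_quotient.repr u).

HB.instance Definition _ s := GRing.RMorphism.on (perm_eval s).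

Lemma perm_evalX s S : perm_eval s (subset_var S) = chow_x (perm_subset s S).
Proof. by rewrite /perm_eval /subset_var mmapX mmap1U enum_rankK. Qed.

Lemma perm_subset_bij s : bijective (perm_subset s).
Proof.
apply: injF_bij => S T /(congr1 val) /= eqST; apply: val_inj.
by apply: imset_inj eqST; exact: perm_inj.
Qed.

Lemma chow_pi_ideal (p : chow_poly) :
  (\pi_chow p == 0) = (p \in chow_ideal).
Proof. by rewrite -(rmorph0 \pi_chow) -Quotient.idealrBE subr0. Qed.

Lemma perm_imset_subset (s : {perm 'I_n.+1}) (A B : {set 'I_n.+1}) :
  (s @: A \subset s @: B) = (A \subset B).
Proof.
apply/idP/idP => [/fintype.subsetP sAB|]; last exact: imsetS.
apply/fintype.subsetP => i Ai; move: (sAB (s i)).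
by rewrite !mem_imset; [exact|exact: perm_inj|exact: perm_inj].
Qed.

Lemma perm_eval_ideal s (p : chow_poly) : p \in chow_ideal -> perm_eval s p = 0.
Proof.
have piG q : (linear_relations `|` incomparable_relations) q -> \pi_chow q = 0.
  move=> Gq; apply/eqP; rewrite chow_pi_ideal; apply/asboolP.
  exists [:: (1, q)]; split=> [u|]; first by rewrite inE => /eqP->.
  by rewrite big_seq1 mul1r.
case/asboolP=> t [tG ->]; rewrite rmorph_sum big_seq big1 // => -[a q] /tG /=.
rewrite rmorphM /=; case=> [[i [j ->]]|[S [T [ST ->]]]].
- have sumE k : perm_eval s (\sum_(S : proper_subset | k \in val S) subset_var S)
      = \pi_chow (\sum_(S : proper_subset | s k \in val S) subset_var S).
    rewrite !rmorph_sum [RHS](reindex (perm_subset s)) /=; last first.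
      exact: onW_bij (perm_subset_bij s).
    apply: eq_big => S; last by move=> _; exact: perm_evalX.
    by rewrite /= mem_imset //; exact: perm_inj.
  rewrite rmorphB /= !sumE -rmorphB /= piG ?mulr0 //.
  by left; exists (s i), (s j).
- rewrite rmorphM /= !perm_evalX -rmorphM /= piG ?mulr0 //.
  right; exists (perm_subset s S), (perm_subset s T); split=> //.
  move: ST; rewrite /comparable_subsets /=.
  by rewrite !perm_imset_subset.
Qed.

Lemma chow_act_pi s (p : chow_poly) : chow_act s (\pi_chow p) = perm_eval s p.
Proof.
apply/eqP; rewrite -subr_eq0 -rmorphB; apply/eqP/perm_eval_ideal.
by rewrite Quotient.idealrBE generic_quotient.reprK.
Qed.

Lemma chow_act_x s S : chow_act s (chow_x S) = chow_x (perm_subset s S).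
Proof. by rewrite chow_act_pi perm_evalX. Qed.

Definition chow_invariants : set chow :=
  [set u | forall s : {perm 'I_n.+1}, chow_act s u = u].

(* L_i for 1 <= i <= n, indexed by i.-1. *)
Definition hypersimplex_coef (i : nat) (S : proper_subset) : rat :=
  (minn (n.+1 - i) #|val S|)%:R
  - (if ord_max \in val S then (n.+1 - i)%N%:R else 0).

Definition hypersimplex_divisor (i : 'I_n) : chow :=
  divisor_class (hypersimplex_coef i.+1).

End ChowRing.

Arguments Pic : clear implicits.
Arguments chow_invariants : clear implicits.
Arguments hypersimplex_divisor : clear implicits.

Section Nef.

Variables (R : realType) (n : nat).

Definition is_cone (s : {set proper_subset n}) : Prop :=
  {in s &, forall S T, comparable_subsets S T}.

(* The pairing of the character m with the ray generator e_S. *)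
Definition ray_pairing (V : zmodType) (m : 'I_n.+1 -> V) (S : proper_subset n) : V :=
  \sum_(i in val S) m i.

(* A smooth projective curve over the complex numbers R[i] is given by its
   function field K, a finite extension of R[i](t). *)
Section Curve.

Variable K : fieldExtType {fraction {poly R[i]}}.

Definition curve_const (z : R[i]) : K := (tofrac z%:P)%:A.

(* The closed points of the curve are the normalized discrete valuations of K
   trivial on the constants. Fixing the value at 0, where the valuation is
   really infinite, makes v unique for each closed point. *)
Definition closed_point (v : K -> int) : Prop :=
  [/\ v 0 = 0,
      forall x y, x != 0 -> y != 0 -> v (x * y) = v x + v y,
      forall x y, x != 0 -> y != 0 -> x + y != 0 ->
        Num.min (v x) (v y) <= v (x + y),
      forall z, z != 0 -> v (curve_const z) = 0
    & exists2 x, x != 0 & v x = 1].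

(* A morphism from the curve to X is a K-point of X. Each K-point is t . g_s
   with s a cone, g_s the distinguished point of its orbit and t in the torus
   (K^* )^(n+1) / K^*. On the affine chart of a cone containing s, a character
   chi^m (with m of coordinate sum zero) regular on that chart takes the value
   chi^m(t) at this point if m vanishes on s, and the value 0 otherwise. *)
Record curve_map := CurveMap {
  orbit_cone : {set proper_subset n};
  torus_coord : 'I_n.+1 -> K;
  orbit_coneP : is_cone orbit_cone;
  torus_coord_neq0 : forall i, torus_coord i != 0 }.

Variable f : curve_map.

(* The image of the closed point v lies in the affine chart of the cone u,
   i.e. all characters regular on this chart pull back into the valuation
   ring of v. *)
Definition maps_into_chart (v : K -> int) (u : {set proper_subset n}) : Prop :=
  [/\ is_cone u, orbit_cone f \subset u
    & forall m : 'I_n.+1 -> int, \sum_i m i = 0 ->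
        (forall S, S \in u -> 0 <= ray_pairing m S) ->
        (forall S, S \in orbit_cone f -> ray_pairing m S = 0) ->
        0 <= v (\prod_i torus_coord f i ^ m i)].

(* Multiplicity at v of the pull-back of the divisor with coefficients c: on
   the chart of u the divisor has local equation chi^m with <m, e_S> = c S on the
   rays of u; the multiplicity is linear in m, which may thus be rational. *)
Definition is_pullback_mult (c : proper_subset n -> rat) (v : K -> int)
    (q : rat) : Prop :=
  exists (u : {set proper_subset n}) (m : 'I_n.+1 -> rat),
    [/\ maps_into_chart v u, \sum_i m i = 0,
        forall S, S \in u -> ray_pairing m S = c S
      & q = \sum_i m i * (v (torus_coord f i))%:~R].

Definition pullback_mult (c : proper_subset n -> rat) (v : K -> int) : rat :=
  xget 0 [set q | is_pullback_mult c v q].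

(* Only finitely many closed points have a nonzero multiplicity, so the default
   value of a sum with infinite support is never used. *)
Definition pullback_degree (c : proper_subset n -> rat) : rat :=
  \sum_(v \in [set v | closed_point v]) pullback_mult c v.

(* The torus-invariant divisor with coefficients c does not contain the image
   of the curve. *)
Definition avoids_curve (c : proper_subset n -> rat) : Prop :=
  forall S, S \in orbit_cone f -> c S = 0.

End Curve.

(* D is nef when D . C >= 0 for all curves C. This number is the degree of the
   pull-back of any divisor of class D that does not contain the curve: such
   divisors always exist, and they all give the same degree. *)
Definition nef (D : chow n) : Prop :=
  forall (K : fieldExtType {fraction {poly R[i]}}) (f : curve_map K),
    exists c : proper_subset n -> rat,
      [/\ D = divisor_class c, avoids_curve f c & 0 <= pullback_degree f c].

Definition nef_cone : set (chow n) := [set D | Pic n D /\ nef D].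

End Nef.

Arguments nef_cone : clear implicits.

(* Main.v *)
Require Import Defs.
From HB Require Import structures.
From mathcomp Require Import all_boot all_order all_algebra all_fingroup all_field.
From mathcomp Require Import ring_quotient fraction zify ring lra.
From mathcomp Require Import boolp classical_sets functions fsbigop.
From mathcomp Require Import reals complex.
From mathcomp.multinomials Require Import mpoly.

(* (a) Trading repeated factors for new ones, the squarefree monomials x_F of
   chains F of subsets span the Chow ring, so their symmetrizations span the
   invariants. Permutations act transitively on the chains with given sizes,
   hence the symmetrization of x_F is a multiple of the product over S in F of
   D_|S|, where D_k is the sum of the x_S with |S| = k; and D_k is a second
   difference of the L_i.
   (b) The section of L_i given by the vertex e_B of the hypersimplex has the
   effective divisor with coefficients min(k, |S|) - |S /\ B|, k = |B|, which
   avoids a given curve for a suitable B, so the L_i are nef. Conversely the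
   torus-invariant curve of the cone of the flag of all initial sets but the one
   of size p+1 meets L_i in one point if n - i = p and in none otherwise
   (1 <= i <= n, 0 <= p < n), so that the coefficients of a nef combination are its
   degrees on these curves. *)

Set Implicit Arguments.
Unset Strict Implicit.
Unset Printing Implicit Defensive.

Import Order.TTheory GRing.Theory Num.Theory.

Local Open Scope ring_scope.
Local Open Scope quotient_scope.
Local Open Scope classical_set_scope.

(** * Relations in the Chow ring and the action of permutations *)

Section ChowRing.

Variable n : nat.

Local Notation subsets := (proper_subset n).

Lemma chow_relation (p : chow_poly n) :
  (@linear_relations n `|` @incomparable_relations n) p -> \pi_(chow n) p = 0 :> chow n.
Proof.
move=> Gp; apply/eqP; rewrite chow_pi_ideal; apply/asboolP.
by exists [:: (1, p)]; split=> [u|]; rewrite ?inE ?big_seq1 ?mul1r // => /eqP->.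
Qed.

Lemma chow_x_incomparable (S T : subsets) :
  ~~ comparable_subsets S T -> chow_x S * chow_x T = 0.
Proof.
move=> ST; rewrite /chow_x -rmorphM; apply: chow_relation.
by right; exists S, T.
Qed.

Lemma sum_chow_x_mem (a b : 'I_n.+1) :
  \sum_(S : subsets | a \in val S) chow_x S
  = \sum_(S : subsets | b \in val S) chow_x S.
Proof.
apply/eqP; rewrite -subr_eq0 /chow_x -!rmorph_sum -rmorphB; apply/eqP/chow_relation.
by left; exists a, b.
Qed.

Lemma chow_piP (u : chow n) : exists p, u = \pi_(chow n) p.
Proof. by exists (generic_quotient.repr u); rewrite generic_quotient.reprK. Qed.

Lemma chow_act_zmod_morphism (s : {perm 'I_n.+1}) : zmod_morphism (chow_act (n:=n) s).
Proof.
move=> u v; have [p ->] := chow_piP u; have [q ->] := chow_piP v.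
by rewrite -rmorphB !chow_act_pi rmorphB.
Qed.

Lemma chow_act_monoid_morphism (s : {perm 'I_n.+1}) :
  monoid_morphism (chow_act (n:=n) s).
Proof.
split=> [|u v]; first by rewrite -[1](rmorph1 \pi_(chow n)) chow_act_pi !rmorph1.
have [p ->] := chow_piP u; have [q ->] := chow_piP v.
by rewrite -rmorphM !chow_act_pi rmorphM.
Qed.

HB.instance Definition _ s := GRing.isZmodMorphism.Build (chow n) (chow n)
  (chow_act (n:=n) s) (chow_act_zmod_morphism s).
HB.instance Definition _ s := GRing.isMonoidMorphism.Build (chow n) (chow n)
  (chow_act (n:=n) s) (chow_act_monoid_morphism s).

Lemma chow_actZ s a (u : chow n) : chow_act s (a *: u) = a *: chow_act s u.
Proof.
have [p ->] := chow_piP u.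
have -> : a *: \pi_(chow n) p = \pi_(chow n) (a%:MP * p) by rewrite rmorphM.
by rewrite !chow_act_pi rmorphM /= [perm_eval s a%:MP]mmapC mulr_algl.
Qed.

(** * Spanning of the Chow ring by squarefree chain monomials *)

Definition chain_mono (F : {set subsets}) : chow n := \prod_(S in F) chow_x S.

Definition chain_combination (u : chow n) : Prop :=
  exists c : {set subsets} -> rat,
    u = \sum_(F : {set subsets} | `[< is_cone F >]) c F *: chain_mono F.

Lemma chain_combinationP a u v :
  chain_combination u -> chain_combination v -> chain_combination (a *: u + v).
Proof.
move=> [c ->] [d ->]; exists (fun F => a * c F + d F).
rewrite scaler_sumr -big_split /=; apply: eq_bigr => F _.
by rewrite scalerA -scalerDl.
Qed.

Lemma chain_combination0 : chain_combination 0.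
Proof. by exists (fun=> 0); rewrite big1 // => F _; rewrite scale0r. Qed.

Lemma chain_combinationZ a u : chain_combination u -> chain_combination (a *: u).
Proof.
by move=> hu; rewrite -[a *: u]addr0; apply: chain_combinationP chain_combination0.
Qed.

Lemma chain_combination_sum (I : Type) (r : seq I) (P : pred I) (f : I -> chow n) :
  (forall i, P i -> chain_combination (f i)) ->
  chain_combination (\sum_(i <- r | P i) f i).
Proof.
move=> hf; elim/big_rec: _ => [|i u Pi hu]; first exact: chain_combination0.
by rewrite -[f i]scale1r; apply: chain_combinationP => //; apply: hf.
Qed.

Lemma chain_combination_mono (F : {set subsets}) :
  is_cone F -> chain_combination (chain_mono F).
Proof.
move=> cF; exists (fun F' => (F' == F)%:R).
rewrite (bigD1 F) /=; last exact/asboolP.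
rewrite eqxx scale1r big1 ?addr0 // => F' /andP[_ /negbTE->].
by rewrite scale0r.
Qed.

Lemma comparable_subsetsC (S T : subsets) :
  comparable_subsets S T = comparable_subsets T S.
Proof. by rewrite /comparable_subsets orbC. Qed.

(** Either S is comparable with all of F and [S |: F] is a chain, or a factor incomparable to S
    makes the product 0. *)
Lemma chow_x_chain_mono_new (F : {set subsets}) (S : subsets) :
  is_cone F -> S \notin F -> chain_combination (chow_x S * chain_mono F).
Proof.
move=> cF SF; have [/forall_inP cS|] :=
  boolP [forall T in F, comparable_subsets S T].
  have -> : chow_x S * chain_mono F = chain_mono (S |: F).
    by rewrite /chain_mono big_setU1.
  apply: chain_combination_mono => T U /setU1P[->|TF] /setU1P[->|UF].
  - by rewrite /comparable_subsets subxx.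
  - exact: cS.
  - by rewrite comparable_subsetsC cS.
  - exact: cF.
rewrite negb_forall_in => /exists_inP[T TF ST].
rewrite /chain_mono (bigD1 T) //= mulrA chow_x_incomparable // mul0r.
exact: chain_combination0.
Qed.

(* The relation for a in S and b outside S chosen next to S in the chain F lets
   one trade a repeated factor x_S for new factors x_T. *)
Lemma chow_x_chain_mono (F : {set subsets}) (S : subsets) :
  is_cone F -> chain_combination (chow_x S * chain_mono F).
Proof.
move=> cF; have [SF|] := boolP (S \in F); last exact: chow_x_chain_mono_new.
(* [a] is taken in S outside the largest member of F strictly below S, or anywhere in S if there is
   none. *)
have [a aS aT] : exists2 a, a \in val S &
    forall T, T \in F -> val T \proper val S -> a \notin val T.
  have [|/set0Pn[T0]] := eqVneq [set T in F | val T \proper val S]%SET (finset.set0).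
    move=> E; have /andP[/card_gt0P[a aS] _] := valP S.
    exists a => // T TF TS; have : T \in [set T in F | val T \proper val S]%SET.
      by rewrite inE TF.
    by rewrite E inE.
  rewrite inE => T0P; have [T /andP[TF TS] Tmax] := @arg_maxnP _ T0
    (fun T => (T \in F) && (val T \proper val S)) (fun T => #|val T|) T0P.
  have /properP[_ [a aS aT]] := TS; exists a => // U UF US.
  apply: contra aT => aU; have /orP[UT|TU] := cF _ _ UF TF.
    exact: (fintype.subsetP UT).
  suff /eqP-> : val T == val U by [].
  by rewrite eqEcard TU; apply: Tmax; rewrite UF.
(* Dually, [b] is outside S and in the smallest member of F strictly above S, if there is one. *)
have [b bS bT] : exists2 b, b \notin val S &
    forall T, T \in F -> val S \proper val T -> b \in val T.
  have [|/set0Pn[T0]] := eqVneq [set T in F | val S \proper val T]%SET (finset.set0).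
    move=> E; have /andP[_ Sn] := valP S.
    have : (0 < #|~: val S|)%N by rewrite cardsCs finset.setCK card_ord subn_gt0.
    case/card_gt0P=> b; rewrite inE => bS; exists b => // T TF TS.
    have : T \in [set T in F | val S \proper val T]%SET by rewrite inE TF.
    by rewrite E inE.
  rewrite inE => T0P; have [T /andP[TF TS] Tmin] := @arg_minnP _ T0
    (fun T => (T \in F) && (val S \proper val T)) (fun T => #|val T|) T0P.
  have /properP[_ [b bT bS]] := TS; exists b => // U UF US.
  have /orP[UT|TU] := cF _ _ UF TF; last exact: (fintype.subsetP TU).
  suff /eqP-> : val U == val T by [].
  by rewrite eqEcard UT; apply: Tmin; rewrite UF.
have zero (T : subsets) : b \in val T -> a \notin val T ->
    chow_x T * chain_mono F = 0.
  move=> bT' aT'; rewrite /chain_mono (bigD1 S) //= mulrA chow_x_incomparable ?mul0r //.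
  rewrite negb_or; apply/andP; split.
    by apply: contra bS => /fintype.subsetP; apply.
  by apply: contra aT' => /fintype.subsetP; apply.
have split_sum (c d : 'I_n.+1) : \sum_(T : subsets | c \in val T) chow_x T
    = \sum_(T : subsets | (c \in val T) && (d \in val T)) chow_x T
      + \sum_(T : subsets | (c \in val T) && (d \notin val T)) chow_x T.
  by rewrite (bigID (fun T : subsets => d \in val T)).
(* The terms containing both a and b cancel from the relation, and those with b but not a are killed
   by x_S in the monomial. What remains expresses x_S through the other x_T with a in T and b
   outside T. *)
have /eqP := sum_chow_x_mem a b.
rewrite (split_sum a b) (split_sum b a).
under [X in _ == X + _ -> _]eq_bigl => T do rewrite andbC.
rewrite (inj_eq (addrI _)) => /eqP /(congr1 (fun u => u * chain_mono F)).
rewrite [RHS]mulr_suml [RHS]big1 => [|T /andP[]]; last exact: zero.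
rewrite (bigD1 S) ?aS //= mulrDl => /eqP; rewrite addr_eq0 => /eqP->.
rewrite -scaleN1r; apply: chain_combinationZ; rewrite mulr_suml.
apply: chain_combination_sum => T /andP[/andP[aT' bT'] TS].
(* No member T of F other than S occurs here: below S it would miss a, above S it would contain
   b. *)
have [TF|] := boolP (T \in F); last exact: chow_x_chain_mono_new.
case/orP: (cF _ _ TF SF) => sub.
  suff /(aT T TF) : val T \proper val S by rewrite aT'.
  rewrite finset.properEneq sub andbT.
  by apply: contra TS => /eqP/val_inj->.
case/negP: bT'; apply: (bT T TF); rewrite finset.properEneq sub andbT.
by apply: contra TS => /eqP/val_inj->.
Qed.

(** The elements whose multiplication preserves chain combinations are closed under products and
    include the x_S, so all monomials are among them; they are applied to 1, the monomial of the
    empty chain. *)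
Lemma chain_combinationT (u : chow n) : chain_combination u.
Proof.
pose stable (v : chow n) := forall w, chain_combination w -> chain_combination (v * w).
suff : stable u.
  move=> /(_ (chain_mono finset.set0)); rewrite {2}/chain_mono big_set0 mulr1; apply.
  by apply: chain_combination_mono => S T; rewrite inE.
have stableM v w : stable v -> stable w -> stable (v * w).
  by move=> hv hw z hz; rewrite -mulrA; apply/hv/hw.
have stableX S : stable (chow_x S).
  move=> _ [c ->]; rewrite mulr_sumr; apply: chain_combination_sum => F /asboolP cF.
  by rewrite -scalerAr; apply/chain_combinationZ/chow_x_chain_mono.
have stable1 : stable 1 by move=> w; rewrite mul1r.
have [p ->] := chow_piP u; rewrite (mpolyE p) rmorph_sum => w hw.
rewrite mulr_suml; apply: chain_combination_sum => m _ /=.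
rewrite -mul_mpolyC rmorphM /= -mulrA; apply: (chain_combinationZ p@_m).
suff : stable (\pi_(chow n) 'X_[m]) by apply.
rewrite mpolyXE_id rmorph_prod; apply: big_ind => // i _.
rewrite rmorphXn /=; elim: (m i) => [|k IH]; first by rewrite expr0.
by rewrite exprS; apply: stableM IH; rewrite -(enum_valK i); apply: stableX.
Qed.

(** * Permutations carrying chains to chains *)

Definition initial (k : nat) : {set 'I_n.+1} := [set i : 'I_n.+1 | (i < k)%N]%SET.

Lemma card_initial k : (k <= n.+1)%N -> #|initial k| = k.
Proof.
move=> kn; rewrite -sum1dep_card -(big_ord_widen _ (fun=> 1%N)) //.
by rewrite sum1_card card_ord.
Qed.

Lemma perm_subsetM (s t : {perm 'I_n.+1}) (S : subsets) :
  perm_subset (s * t)%g S = perm_subset t (perm_subset s S).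
Proof.
apply: val_inj => /=; rewrite -imset_comp.
by apply: eq_imset => i; rewrite /= permM.
Qed.

(** The elements of [n] are sorted by decreasing number of members of F that contain them; each
    member of F then becomes an initial segment. *)
Lemma chain_straighten (F : {set subsets}) : is_cone F ->
  exists s : {perm 'I_n.+1},
    forall S, S \in F -> s @: val S = initial #|val S|.
Proof.
move=> cF; pose cnt (i : 'I_n.+1) := #|[set S in F | i \in val S]%SET|.
pose e := sort (fun i j => cnt j <= cnt i)%N (enum 'I_n.+1).
have e_uniq : uniq e by rewrite sort_uniq enum_uniq.
have e_mem i : i \in e by rewrite mem_sort mem_enum.
have e_size : size e = n.+1 by rewrite size_sort size_enum_ord.
have e_lt i : (index i e < n.+1)%N by rewrite -[X in (_ < X)%N]e_size index_mem.
have inj_s : injective (fun i => Ordinal (e_lt i)).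
  move=> i j /(congr1 (fun k : 'I__ => nth i e k)) /=.
  by rewrite !nth_index.
exists (perm inj_s) => S SF; apply/eqP; rewrite eqEcard; apply/andP; split; last first.
  rewrite card_imset; last exact: perm_inj.
  by rewrite card_initial // (leq_trans (max_card _)) ?card_ord.
apply/fintype.subsetP=> _ /imsetP[i iS ->]; rewrite inE permE /=.
(* It suffices that the entries of [e] up to i, which are [(index i e).+1] in number, all lie in
   S. *)
rewrite cardE -[index i e]/((index i e).+1.-1) prednK // .
have <- : size (take (index i e).+1 e) = (index i e).+1.
  by rewrite size_takel // e_size e_lt.
apply: uniq_leq_size => [|j]; first exact: take_uniq.
rewrite mem_enum => /(nthP i)[k]; rewrite size_takel ?e_size ?e_lt // => ki.
rewrite nth_take // => <-; set j' := nth i e k.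
have le_cnt : (cnt i <= cnt j')%N.
  have -> : cnt i = cnt (nth i e (index i e)) by rewrite nth_index.
  apply: (@sorted_leq_nth _ (fun i j => cnt j <= cnt i)%N) => //.
  - by move=> y x z xy yz; apply: leq_trans xy.
  - by apply: sort_sorted => x y; apply: leq_total.
  - by rewrite inE e_size (leq_trans ki) // e_lt.
  - by rewrite inE e_size e_lt.
(* If [j'] were outside S, every member of F containing [j'] would contain S and hence i, while S
   itself contains i but not [j']. *)
apply: contraLR le_cnt => jS; rewrite -ltnNge; apply: proper_card.
apply/properP; split; last by exists S; rewrite !inE SF ?iS // (negbTE jS).
apply/fintype.subsetP=> T; rewrite !inE => /andP[TF jT]; rewrite TF /=.
case/orP: (cF _ _ SF TF) => /fintype.subsetP sub; first exact: sub.
by rewrite sub in jS.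
Qed.

(** As g preserves sizes, F and its image straighten to the same initial sets; one straightening is
    composed with the inverse of the other. *)
Lemma chain_transitive (F : {set subsets}) (g : subsets -> subsets) :
  is_cone F -> {in F &, forall S T, comparable_subsets (g S) (g T)} ->
  {in F, forall S, #|val (g S)| = #|val S|} ->
  exists s : {perm 'I_n.+1}, {in F, forall S, perm_subset s S = g S}.
Proof.
move=> cF cg card_g; have [s sP] := chain_straighten cF.
have [|t tP] := @chain_straighten (g @: F).
  by move=> _ _ /imsetP[S SF ->] /imsetP[T TF ->]; apply: cg.
exists (s * t^-1)%g => S SF; rewrite perm_subsetM; apply: val_inj => /=.
have <- : t @: val (g S) = s @: val S.
  by rewrite sP // tP ?card_g // imset_f.
rewrite -imset_comp -[RHS]imset_id.
by apply: eq_imset => i; rewrite /= permK.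
Qed.

(** * Symmetrization over the symmetric group *)

Definition chow_sym (u : chow n) : chow n :=
  \sum_(s : {perm 'I_n.+1}) chow_act s u.

Lemma chow_sym_sum (I : Type) (r : seq I) (P : pred I) (c : I -> rat) (f : I -> chow n) :
  chow_sym (\sum_(i <- r | P i) c i *: f i) = \sum_(i <- r | P i) c i *: chow_sym (f i).
Proof.
rewrite /chow_sym; under eq_bigr do rewrite rmorph_sum; rewrite exchange_big /=.
by apply: eq_bigr => i _; rewrite scaler_sumr; apply: eq_bigr => s _; rewrite chow_actZ.
Qed.

Lemma chow_sym_invariant (u : chow n) : chow_invariants n u ->
  u = #|{perm 'I_n.+1}|%:R^-1 *: chow_sym u.
Proof.
move=> inv_u; rewrite /chow_sym; under eq_bigr do rewrite inv_u.
rewrite sumr_const -scaler_nat scalerA mulVf ?scale1r // pnatr_eq0.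
by rewrite -lt0n; apply/card_gt0P; exists 1%g.
Qed.

(** A permutation taking each S in F to g S only reindexes the sum over the group. *)
Lemma chow_sym_chain (F : {set subsets}) (g : subsets -> subsets) :
  is_cone F -> {in F &, forall S T, comparable_subsets (g S) (g T)} ->
  {in F, forall S, #|val (g S)| = #|val S|} ->
  chow_sym (\prod_(S in F) chow_x (g S)) = chow_sym (chain_mono F).
Proof.
move=> cF cg card_g; have [t tP] := chain_transitive cF cg card_g.
rewrite /chow_sym [RHS](reindex_inj (mulgI t)); apply: eq_bigr => s _.
rewrite /chain_mono !rmorph_prod; apply: eq_bigr => S SF.
by rewrite /= !chow_act_x perm_subsetM tP.
Qed.

(** * Divisor classes and the hypersimplex classes *)

Lemma divisor_classP a (c d : subsets -> rat) :
  a *: divisor_class c + divisor_class d = divisor_class (fun S => a * c S + d S).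
Proof.
rewrite /divisor_class scaler_sumr -big_split; apply: eq_bigr => S _ /=.
by rewrite scalerA -scalerDl.
Qed.

Lemma divisor_class_sum k (a : 'I_k -> rat) (c : 'I_k -> subsets -> rat) :
  \sum_i a i *: divisor_class (c i) = divisor_class (fun S => \sum_i a i * c i S).
Proof.
rewrite /divisor_class; under eq_bigr do rewrite scaler_sumr.
rewrite exchange_big; apply: eq_bigr => S _ /=.
by rewrite scaler_suml; apply: eq_bigr => i _; rewrite scalerA.
Qed.

Lemma chow_act_divisor s (c : subsets -> rat) :
  chow_act s (divisor_class c) = \sum_S c S *: chow_x (perm_subset s S).
Proof.
by rewrite rmorph_sum; apply: eq_bigr => S _; rewrite /= chow_actZ chow_act_x.
Qed.

Lemma chow_act_size_class s (f : nat -> rat) :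
  chow_act s (divisor_class (fun S : subsets => f #|val S|))
  = divisor_class (fun S : subsets => f #|val S|).
Proof.
rewrite chow_act_divisor /divisor_class [RHS](reindex (perm_subset s)) /=; last first.
  exact: onW_bij (perm_subset_bij s).
by apply: eq_bigr => S _; rewrite card_imset //; apply: perm_inj.
Qed.

(** This class carries the dependence of L_i on the distinguished element; by the linear relations
    it is the same for every a. *)
Definition point_class (a : 'I_n.+1) : chow n :=
  divisor_class (fun S => (a \in val S)%:R).

Lemma point_classC a b : point_class a = point_class b.
Proof.
suff E c : point_class c = \sum_(S : subsets | c \in val S) chow_x S.
  by rewrite !E; apply: sum_chow_x_mem.
rewrite big_mkcond; apply: eq_bigr => S _.
by case: ifP => _; rewrite ?scale1r ?scale0r.
Qed.

Lemma chow_act_point s a : chow_act s (point_class a) = point_class (s a).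
Proof.
rewrite chow_act_divisor /point_class /divisor_class [RHS](reindex (perm_subset s)) /=; last first.
  exact: onW_bij (perm_subset_bij s).
by apply: eq_bigr => S _; rewrite mem_imset //; apply: perm_inj.
Qed.

(** The parameter is k = n + 1 - i. The values k = 0 and k = n + 1, which give the zero class, are
    allowed so that second differences have one form for all sizes. *)
Definition hypersimplex_class (k : nat) : chow n :=
  divisor_class (fun S => (minn k #|val S|)%:R - (if ord_max \in val S then k%:R else 0)).

(* The divisor of the section of L_i given by the vertex e_B of the hypersimplex. *)
Lemma hypersimplex_class_vertex (B : {set 'I_n.+1}) :
  hypersimplex_class #|B|
  = divisor_class (fun S => (minn #|B| #|val S|)%:R - #|val S :&: B|%:R).
Proof.
have -> : divisor_class (fun S : subsets => (minn #|B| #|val S|)%:R - #|val S :&: B|%:R)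
   = -1 *: \sum_(b in B) point_class b
     + divisor_class (fun S : subsets => (minn #|B| #|val S|)%:R).
  rewrite scaleN1r /point_class /divisor_class exchange_big -sumrN -big_split.
  apply: eq_bigr => S _ /=; rewrite -scaler_suml -scaleNr -scalerDl; congr (_ *: _).
  rewrite addrC; congr (- _ + _); rewrite -natr_sum; congr _%:R.
  rewrite -sum1_card [RHS]big_mkcond [LHS]big_mkcond; apply: eq_bigr => i _.
  by rewrite finset.in_setI andbC; case: (i \in B); case: (i \in val S).
have -> : \sum_(b in B) point_class b = #|B|%:R *: point_class ord_max.
  by rewrite (eq_bigr (fun=> point_class ord_max)) ?sumr_const ?scaler_nat // => b _;
    apply: point_classC.
rewrite scalerA divisor_classP; apply: eq_bigr => S _; congr (_ *: _).
by case: ifP => _; rewrite ?mulr1 ?mulr0 ?subr0 ?add0r // mulN1r addrC.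
Qed.

Lemma hypersimplex_class0 : hypersimplex_class 0 = 0.
Proof.
rewrite /hypersimplex_class /divisor_class big1 // => S _.
by rewrite min0n if_same subrr scale0r.
Qed.

Lemma hypersimplex_classSn : hypersimplex_class n.+1 = 0.
Proof.
(* With the full set as B, every coefficient becomes |S| - |S|. *)
rewrite -[n.+1](card_ord) -cardsT hypersimplex_class_vertex.
rewrite /divisor_class big1 // => S _.
rewrite finset.setIT cardsT card_ord (minn_idPr _) ?subrr ?scale0r //.
by have /andP[_ /ltnW] := valP S.
Qed.

Lemma hypersimplex_divisorE (i : 'I_n) :
  hypersimplex_divisor n i = hypersimplex_class (n.+1 - i.+1).
Proof. by []. Qed.

(** The class is a multiple of the point class plus a divisor depending on sizes only, and
    permutations fix both. *)
Lemma chow_act_hypersimplex s k :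
  chow_act s (hypersimplex_class k) = hypersimplex_class k.
Proof.
have -> : hypersimplex_class k = - k%:R *: point_class ord_max
    + divisor_class (fun S : subsets => (minn k #|val S|)%:R).
  rewrite divisor_classP; apply: eq_bigr => S _; congr (_ *: _).
  by case: ifP => _; rewrite ?mulr1 ?mulr0 ?subr0 ?add0r // addrC.
rewrite rmorphD /= chow_actZ chow_act_point (point_classC _ ord_max).
by rewrite (chow_act_size_class _ (fun j => (minn k j)%:R)).
Qed.

(** * Divisors of subsets of equal size, and the invariants *)

Definition size_divisor (k : nat) : chow n :=
  divisor_class (fun S => (#|val S| == k)%:R).

Lemma size_divisorE k :
  size_divisor k = \sum_(S : subsets | #|val S| == k) chow_x S.
Proof.
rewrite [RHS]big_mkcond; apply: eq_bigr => S _.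
by case: ifP => _; rewrite ?scale1r ?scale0r.
Qed.

(* The second difference of min(k, j) in k is -[k = j]. *)
Lemma size_divisor_hypersimplex k :
  size_divisor k.+1 = 2 *: hypersimplex_class k.+1
    + (-1 *: hypersimplex_class k + (-1 *: hypersimplex_class k.+2 + 0)).
Proof.
rewrite addr0 -[-1 *: hypersimplex_class k.+2]addr0 -[in RHS]hypersimplex_class0.
rewrite !divisor_classP; apply: eq_bigr => S _; congr (_ *: _).
rewrite min0n if_same subrr addr0.
have E : ((#|val S| == k.+1) + minn k #|val S| + minn k.+2 #|val S|
    = 2 * minn k.+1 #|val S|)%N by lia.
have := congr1 (fun j => j%:R : rat) E; rewrite natrM !natrD => ER.
by case: ifP => _; rewrite -?natr1; lra.
Qed.

(** [W] is any linear subspace containing the L_i; it is applied to a subalgebra and to the linear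
    span of the L_i. *)
Lemma size_divisor_ind (W : chow n -> Prop) :
  W 0 -> (forall a u v, W u -> W v -> W (a *: u + v)) ->
  (forall i, W (hypersimplex_divisor n i)) ->
  forall S : subsets, W (size_divisor #|val S|).
Proof.
move=> W0 WZD WL S; have /andP[] := valP S; case: #|val S| => // k _ kn.
have Wk j : (j <= n.+1)%N -> W (hypersimplex_class j).
  case: j => [|j]; first by rewrite hypersimplex_class0.
  rewrite leq_eqVlt => /orP[/eqP->|]; first by rewrite hypersimplex_classSn.
  (* The class with parameter j + 1 is L_i for i = n - j; ordinals start at 0, whence [n - j.+1]. *)
  move=> jn; have lt_i : (n - j.+1 < n)%N by lia.
  have := WL (Ordinal lt_i); rewrite hypersimplex_divisorE /=.
  by have -> : (n.+1 - (n - j.+1).+1 = j.+1)%N by lia.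
rewrite size_divisor_hypersimplex.
by do 3![apply: (WZD); first by apply: Wk; lia].
Qed.

(** The product of the D_|S| expands over the choices g of sets of the same sizes. Choices that are
    not chains contribute 0, and each of the m others has the symmetrization of [chain_mono F]. The
    product is invariant, so symmetrizing it only multiplies it by the group order. *)
Lemma chow_sym_chain_mono (F : {set subsets}) : is_cone F ->
  exists r : rat,
    chow_sym (chain_mono F) = r *: \prod_(S in F) size_divisor #|val S|.
Proof.
move=> cF; set Q := \prod_(S in F) _.
have symQ : chow_sym Q = #|{perm 'I_n.+1}|%:R *: Q.
  rewrite /chow_sym (eq_bigr (fun=> Q)) ?sumr_const ?scaler_nat // => s _.
  rewrite rmorph_prod; apply: eq_bigr => S _ /=.
  by rewrite (chow_act_size_class _ (fun j => (j == #|val S|)%:R)).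
(* A member [S0] is needed as the default value of the choice functions outside F. *)
have [F0|[S0 S0F]] := set_0Vmem F.
  exists #|{perm 'I_n.+1}|%:R; rewrite -symQ /Q /chain_mono F0 !big_set0 //.
pose G : pred {ffun subsets -> subsets} :=
  [pred g : {ffun subsets -> subsets} | [forall S in F, forall T in F, comparable_subsets (g S) (g T)]].
pose fam := [pred g : {ffun subsets -> subsets} | g \in pfamily S0 (mem F) (fun S : subsets => [pred T : subsets | #|val T| == #|val S|])].
have famP g : g \in fam -> {in F, forall S, #|val (g S)| = #|val S|}.
  by rewrite inE => /pfamilyP[_ h] S /h /eqP.
pose m := #|[pred g | (g \in fam) && G g]|.
have EQ : chow_sym Q = m%:R *: chow_sym (chain_mono F).
  rewrite /Q; under eq_bigr do rewrite size_divisorE.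
  rewrite (big_distr_big_dep S0) /=.
  under eq_bigr do rewrite -[\prod_(_ in _) _]scale1r.
  rewrite (chow_sym_sum _ _ (fun=> 1)) (bigID G) /= addrC big1 ?add0r; last first.
    move=> g /andP[_]; rewrite negb_forall_in => /exists_inP[S SF].
    rewrite negb_forall_in => /exists_inP[T TF ST].
    have neTS : T != S by apply: contraNneq ST => ->; rewrite /comparable_subsets subxx.
    rewrite (bigD1 S) //= (bigD1 T) /= ?TF // mulrA chow_x_incomparable // mul0r.
    by rewrite scale1r /chow_sym big1 // => s _; rewrite rmorph0.
  rewrite (eq_bigr (fun=> chow_sym (chain_mono F))).
    by rewrite sumr_const scaler_nat.
  move=> g /andP[g_fam /forall_inP gG]; rewrite scale1r chow_sym_chain //.
    by move=> S T SF TF; have /forall_inP := gG _ SF; apply.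
  exact: famP.
have m_gt0 : m%:R != 0 :> rat.
  rewrite pnatr_eq0 -lt0n; apply/card_gt0P.
  exists [ffun S => if S \in F then S else S0]; rewrite !inE; apply/andP; split.
    apply/pfamilyP; split=> [|S SF]; last by rewrite ffunE SF inE.
    by apply/fintype.subsetP => S; rewrite inE ffunE; case: ifP => //; rewrite eqxx.
  apply/forall_inP => S SF; apply/forall_inP => T TF.
  by rewrite !ffunE SF TF cF.
exists (m%:R^-1 * #|{perm 'I_n.+1}|%:R).
by rewrite -scalerA -symQ EQ scalerA mulVf // scale1r.
Qed.

Lemma subalgebra_hypersimplex :
  subalgebra_span (range (hypersimplex_divisor n)) = chow_invariants n.
Proof.
apply/seteqP; split=> u.
  move=> /(_ (fun u => `[< chow_invariants n u >])) uL; apply/asboolP/uL.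
    split; first by apply/asboolP => s; rewrite rmorph1.
      move=> a v w /asboolP hv /asboolP hw; apply/asboolP => s.
      by rewrite rmorphD /= chow_actZ hv hw.
    move=> v w /asboolP hv /asboolP hw; apply/asboolP => s.
    by rewrite rmorphM /= hv hw.
  move=> _ [i _ <-]; apply/asboolP => s; exact: chow_act_hypersimplex.
move=> inv_u P [P1 PZD PM] PL; have P0 : 0 \in P.
  by rewrite -(subrr 1) -scaleN1r addrC; apply: (PZD).
have PZ a v : v \in P -> a *: v \in P.
  by move=> Pv; rewrite -[_ *: _]addr0; apply: (PZD).
rewrite (chow_sym_invariant inv_u); apply: (PZ).
have [c ->] := chain_combinationT u; rewrite chow_sym_sum.
apply: (big_ind (fun v => v \in P)) => // [v w Pv Pw|F /asboolP cF].
  by rewrite -[v]scale1r; apply: (PZD).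
have [r ->] := chow_sym_chain_mono cF; rewrite scalerA; apply: (PZ).
apply: (big_ind (fun v => v \in P)) => // S _.
by apply: (size_divisor_ind (W := fun v => v \in P)) => // i; apply: PL; exists i.
Qed.

(** A single set is a chain, so symmetrizing x_S gives a multiple of D_|S|, which lies in the span
    of the L_i. *)
Lemma invariant_divisor_combination (u : chow n) : Pic n u -> chow_invariants n u ->
  exists a : 'I_n -> rat, u = \sum_i a i *: hypersimplex_divisor n i.
Proof.
move=> [c _ <-] /chow_sym_invariant ->.
pose W v := exists a : 'I_n -> rat, v = \sum_i a i *: hypersimplex_divisor n i.
have W0 : W 0 by exists (fun=> 0); rewrite big1 // => i _; rewrite scale0r.
have WZD a v w : W v -> W w -> W (a *: v + w).
  move=> [b ->] [b' ->]; exists (fun i => a * b i + b' i).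
  rewrite scaler_sumr -big_split; apply: eq_bigr => i _ /=.
  by rewrite scalerA -scalerDl.
have WZ a v : W v -> W (a *: v) by move=> hv; rewrite -[_ *: _]addr0; apply: (WZD).
apply: (WZ); rewrite chow_sym_sum; elim/big_rec: _ => // S v _ Wv; apply: (WZD _ _ _ _ Wv).
have -> : chow_x S = chain_mono (finset.set1 S) by rewrite /chain_mono big_set1.
have [|r ->] := @chow_sym_chain_mono (finset.set1 S).
  by move=> T U; rewrite !inE => /eqP-> /eqP->; rewrite /comparable_subsets subxx.
rewrite big_set1; apply: (WZ); apply: (size_divisor_ind (W := W)) => // i.
exists (fun j => (j == i)%:R); rewrite (bigD1 i) //= eqxx scale1r big1 ?addr0 //.
by move=> j /negbTE->; rewrite scale0r.
Qed.

End ChowRing.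

Arguments initial {n} k.

(** * Degrees on the flag curves as functionals on divisor classes *)

Section ChowDegree.

Variable n : nat.

Local Notation subsets := (proper_subset n).

Definition linear_coef (S : subsets) (p : chow_poly n) : rat :=
  (p^`M(enum_rank S)).@[fun=> 0].

Lemma linear_coef_is_zmod_morphism S : zmod_morphism (linear_coef S).
Proof. by move=> p q; rewrite /linear_coef mderivB mevalB. Qed.

HB.instance Definition _ S := GRing.isZmodMorphism.Build (chow_poly n) rat
  (linear_coef S) (linear_coef_is_zmod_morphism S).

Lemma linear_coefM (p q : chow_poly n) S :
  linear_coef S (p * q) = linear_coef S p * q.@[fun=> 0] + p.@[fun=> 0] * linear_coef S q.
Proof. by rewrite /linear_coef mderivM mevalD !mevalM. Qed.

Lemma linear_coef_var S T : linear_coef T (subset_var S) = (S == T)%:R.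
Proof.
rewrite /linear_coef /subset_var mderivX mevalZ mnm1E (inj_eq enum_rank_inj).
have [->|] := eqVneq; last by rewrite mul0r.
have -> : (U_(enum_rank T) - U_(enum_rank T) = 0)%MM.
  by apply/mnmP=> i; rewrite mnmBE mnm0E subnn.
by rewrite mpolyX0 mul1r meval1.
Qed.

Lemma subset_var_at0 S : (subset_var (S : subsets)).@[fun=> 0] = 0 :> rat.
Proof. exact: mevalXU. Qed.

(** The value 0 on the empty and the full set, which index no ray, keeps the degree formula uniform
    at both ends of the flag. *)
Definition subset_value (c : subsets -> rat) (B : {set 'I_n.+1}) : rat :=
  oapp c 0 (insub B).

(** For p < n, this is the only set besides [initial p.+1] strictly between [initial p] and
    [initial p.+2]. *)
Definition initial_swap (p : nat) : {set 'I_n.+1} :=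
  [set i : 'I_n.+1 | (i < p)%N || (i == p.+1 :> nat)]%SET.

(* The intersection number of the divisor c with the torus-invariant curve of the
   cone spanned by the flag of all initial sets but initial p.+1. *)
Definition flag_curve_degree (p : nat) (c : subsets -> rat) : rat :=
  subset_value c (initial p.+1) + subset_value c (initial_swap p)
  - subset_value c (initial p) - subset_value c (initial p.+2).

Lemma eq_subset_value c d B : c =1 d -> subset_value c B = subset_value d B.
Proof. by move=> cd; rewrite /subset_value; case: insub => //= S; rewrite cd. Qed.

Lemma subset_value_val c (S : subsets) : subset_value c (val S) = c S.
Proof. by rewrite /subset_value valK. Qed.

Lemma subset_valueP a c d B :
  subset_value (fun S => a * c S + d S) B = a * subset_value c B + subset_value d B.
Proof. by rewrite /subset_value; case: insub => //=; rewrite mulr0 addr0. Qed.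

Lemma subset_value_fun (f : {set 'I_n.+1} -> rat) B :
  f finset.set0 = 0 -> f [set: 'I_n.+1]%SET = 0 ->
  subset_value (fun S => f (val S)) B = f B.
Proof.
move=> f0 fT; rewrite /subset_value; case: insubP => [S _ /= -> //|/=].
rewrite negb_and lt0n negbK -leqNgt => /orP[/eqP/cards0_eq->//|].
move=> BT; suff /eqP -> : B == [set: 'I_n.+1]%SET by [].
by rewrite eqEcard finset.subsetT cardsT card_ord.
Qed.

Lemma flag_curve_degreeP p a c d :
  flag_curve_degree p (fun S => a * c S + d S)
  = a * flag_curve_degree p c + flag_curve_degree p d.
Proof. by rewrite /flag_curve_degree !subset_valueP; ring. Qed.

Lemma eq_flag_curve_degree p c d : c =1 d -> flag_curve_degree p c = flag_curve_degree p d.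
Proof. by move=> cd; rewrite /flag_curve_degree !(eq_subset_value _ cd). Qed.

Lemma flag_curve_degree0 p : flag_curve_degree p (fun=> 0) = 0.
Proof.
have := flag_curve_degreeP p 1 (fun=> 0) (fun=> 0).
rewrite (@eq_flag_curve_degree _ _ (fun=> 0)) => [|S]; last by rewrite mulr0 addr0.
by lra.
Qed.

Lemma flag_curve_degree_sum (I : Type) (r : seq I) p (a : I -> rat)
    (c : I -> subsets -> rat) :
  flag_curve_degree p (fun S => \sum_(i <- r) a i * c i S)
  = \sum_(i <- r) a i * flag_curve_degree p (c i).
Proof.
elim: r => [|i r IH].
  by rewrite big_nil -[RHS](flag_curve_degree0 p); apply: eq_flag_curve_degree => S; rewrite big_nil.
rewrite big_cons -IH -flag_curve_degreeP.
by apply: eq_flag_curve_degree => S; rewrite big_cons.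
Qed.

(** Generators have no constant term, so a multiplier enters only through its constant term.
    Products of two variables have no linear part. For a linear relation the degree vanishes since
    [initial p.+1] and [initial_swap p] together have the elements of [initial p] and
    [initial p.+2], with multiplicity. *)
Lemma flag_curve_degree_ideal p (q : chow_poly n) :
  q \in @chow_ideal n -> flag_curve_degree p (linear_coef^~ q) = 0.
Proof.
case/asboolP=> t [tG ->].
have -> : flag_curve_degree p (linear_coef^~ (\sum_(u <- t) u.1 * u.2))
    = \sum_(u <- t) 1 * flag_curve_degree p (linear_coef^~ (u.1 * u.2)).
  rewrite -flag_curve_degree_sum; apply: eq_flag_curve_degree => S.
  by rewrite (raddf_sum (linear_coef S)); apply: eq_bigr => u _; rewrite mul1r.
rewrite big_seq big1 // => -[f g] /tG /= Gg; rewrite mul1r.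
suff [g0 degg] : g.@[fun=> 0] = 0 /\ flag_curve_degree p (linear_coef^~ g) = 0.
  have := flag_curve_degreeP p f.@[fun=> 0] (linear_coef^~ g) (fun=> 0).
  rewrite degg mulr0 flag_curve_degree0 addr0 => E; rewrite -[RHS]E.
  by apply: eq_flag_curve_degree => S; rewrite linear_coefM g0 mulr0 add0r addr0.
case: Gg => [[a [b ->]]|[S [T [ST ->]]]]; last first.
  rewrite mevalM !subset_var_at0 mulr0; split=> //.
  rewrite -[RHS](flag_curve_degree0 p); apply: eq_flag_curve_degree => U.
  by rewrite linear_coefM !subset_var_at0 mulr0 mul0r addr0.
split.
  by rewrite mevalB !(raddf_sum (meval (fun=> 0))) /= !big1 ?subr0 // => S _;
    exact: subset_var_at0.
have lin_sum (c : 'I_n.+1) S :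
    linear_coef S (\sum_(U : subsets | c \in val U) subset_var U) = (c \in val S)%:R.
  rewrite (raddf_sum (linear_coef S)) /= big_mkcond (bigD1 S) //= linear_coef_var eqxx.
  rewrite big1 => [|U /negbTE US]; first by case: (c \in _); rewrite addr0.
  by case: ifP => // _; rewrite linear_coef_var US.
pose h (B : {set 'I_n.+1}) : rat := (a \in B)%:R - (b \in B)%:R.
rewrite (@eq_flag_curve_degree _ _ (fun S => h (val S))) => [|S]; last first.
  by rewrite (raddfB (linear_coef S)) /= !lin_sum.
rewrite /flag_curve_degree !subset_value_fun ?/h ?inE ?subrr //.
have E (i : 'I_n.+1) : ((i < p.+1)%N%:R + ((i < p)%N || (i == p.+1 :> nat))%:R
    = (i < p)%N%:R + (i < p.+2)%N%:R :> rat).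
  by rewrite -!natrD; congr _%:R; lia.
have := E a; have := E b; lra.
Qed.

Lemma divisor_class_pi (c : subsets -> rat) :
  divisor_class c = \pi_(chow n) (\sum_S c S *: subset_var S).
Proof.
rewrite rmorph_sum; apply: eq_bigr => S _.
by rewrite -mul_mpolyC rmorphM.
Qed.

Lemma flag_curve_degree_class p (c d : subsets -> rat) :
  divisor_class c = divisor_class d -> flag_curve_degree p c = flag_curve_degree p d.
Proof.
have lin (e : subsets -> rat) S : linear_coef S (\sum_T e T *: subset_var T) = e S.
  rewrite (raddf_sum (linear_coef S)) /= (bigD1 S) //= big1 ?addr0 => [|T TS].
    by rewrite /linear_coef mderivZ mevalZ [X in _ * X]linear_coef_var eqxx mulr1.
  by rewrite /linear_coef mderivZ mevalZ [X in _ * X]linear_coef_var (negbTE TS) mulr0.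
rewrite !divisor_class_pi => /eqP; rewrite -subr_eq0 -rmorphB chow_pi_ideal.
move/(flag_curve_degree_ideal p) => deg0.
apply/eqP; rewrite -subr_eq0; apply/eqP.
rewrite -[RHS]deg0 [LHS]addrC -[- flag_curve_degree p d]mulN1r -flag_curve_degreeP.
apply: eq_flag_curve_degree => S.
by rewrite (raddfB (linear_coef S)) /= !lin mulN1r addrC.
Qed.

(** The minima contribute minus the second difference of min(k, j) at j = p + 1, and the terms of
    [ord_max] cancel. *)
Lemma flag_curve_degree_hypersimplex p k : (0 < k <= n)%N -> (p < n)%N ->
  flag_curve_degree p (fun S => (minn k #|val S|)%:R - (if ord_max \in val S then k%:R else 0))
  = (k == p.+1)%:R.
Proof.
move=> /andP[k_gt0 kn] pn.
pose f (B : {set 'I_n.+1}) : rat :=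
  (minn k #|B|)%:R - (if ord_max \in B then k%:R else 0).
rewrite (@eq_flag_curve_degree _ _ (fun S => f (val S))) //.
rewrite /flag_curve_degree !subset_value_fun /f ?cards0 ?cardsT ?card_ord ?inE ?minn0 ?subr0 //;
  try by rewrite (minn_idPl _) ?subrr // (leq_trans kn).
have -> : #|initial_swap p| = p.+1.
  have -> : initial_swap p = (inord p.+1 |: initial p)%SET.
    by apply/finset.setP => i; rewrite !inE orbC -val_eqE /= inordK.
  by rewrite cardsU1 card_initial ?inE ?inordK; lia.
rewrite !card_initial /=; try lia.
have E1 : ((minn k p.+1 + minn k p.+1) = (k == p.+1) + minn k p + minn k p.+2)%N by lia.
have := congr1 (fun j => j%:R : rat) E1; rewrite !natrD.
(* The element n lies in [initial p.+2] just when n = p + 1, and then also in [initial_swap p]. *)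
have -> : (n < p.+1)%N = false by lia.
have -> : (n < p)%N = false by lia.
have -> : (n < p.+2)%N = (n == p.+1) by lia.
by case: (n == p.+1) => /= E; lra.
Qed.

End ChowDegree.

(** Serves to turn a rational local equation into an integral character, to which the condition
    defining a chart applies. *)
Lemma common_denominator (I : finType) (m : I -> rat) :
  exists2 d : int, 0 < d & exists m' : I -> int, forall i, (m' i)%:~R = d%:~R * m i.
Proof.
exists (\prod_j denq (m j)); first by apply: prodr_gt0 => j _; apply: denq_gt0.
exists (fun i => numq (m i) * \prod_(j | j != i) denq (m j)) => i.
rewrite [in RHS](bigD1 i) //= !intrM mulrAC; congr (_ * _).
by rewrite mulrC numqE.
Qed.

(** * Arithmetic of closed points as valuations *)

Section ClosedPoints.

Variables (R : realType) (K : fieldExtType {fraction {poly R[i]}}).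
Variables (v : K -> int) (v_point : closed_point v).

Lemma closed_point0 : v 0 = 0. Proof. by case: v_point. Qed.

Lemma closed_pointM x y : x != 0 -> y != 0 -> v (x * y) = v x + v y.
Proof. by case: v_point => _ + _ _ _; apply. Qed.

Lemma closed_point1 : v 1 = 0.
Proof.
have /eqP := closed_pointM (oner_neq0 K) (oner_neq0 K).
by rewrite mulr1 -subr_eq0 opprD addrA subrr sub0r oppr_eq0 => /eqP.
Qed.

Lemma closed_pointV x : x != 0 -> v x^-1 = - v x.
Proof.
move=> x0; have xV0 : x^-1 != 0 by rewrite invr_eq0.
have /eqP := closed_pointM x0 xV0.
by rewrite mulfV // closed_point1 eq_sym addrC addr_eq0 => /eqP.
Qed.

Lemma closed_pointX x k : x != 0 -> v (x ^+ k) = v x * k%:Z.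
Proof.
move=> x0; elim: k => [|k IH]; first by rewrite expr0 closed_point1 mulr0.
by rewrite exprS closed_pointM ?expf_neq0 // IH -[k.+1]add1n PoszD mulrDr mulr1.
Qed.

Lemma closed_pointXz x (k : int) : x != 0 -> v (x ^ k) = v x * k.
Proof.
move=> x0; case: k => k; first exact: closed_pointX.
by rewrite NegzE -exprnN closed_pointV ?expf_neq0 // closed_pointX // mulrN.
Qed.

Lemma closed_point_prod (I : finType) (t : I -> K) (m : I -> int) :
  (forall i, t i != 0) -> v (\prod_i t i ^ m i) = \sum_i v (t i) * m i.
Proof.
(* Non-vanishing is carried through the induction, since [v] is additive on nonzero elements
   only. *)
move=> t0; pose P x (k : int) := x != 0 /\ v x = k.
suff [] : P (\prod_i t i ^ m i) (\sum_i v (t i) * m i) by [].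
elim/big_rec2: _ => [|i k x _ [x0 <-]]; first by split; rewrite ?oner_neq0 ?closed_point1.
have ti0 : t i ^ m i != 0 by rewrite expfz_neq0.
by split; rewrite ?mulf_neq0 // closed_pointM // closed_pointXz.
Qed.

End ClosedPoints.

(** * Effective divisors and the nefness of the hypersimplex classes *)

Section EffectivePullback.

Variables (R : realType) (n : nat) (K : fieldExtType {fraction {poly R[i]}}).
Variables (f : curve_map n K) (c : proper_subset n -> rat).
Hypotheses (c_ge0 : forall S, 0 <= c S) (c_avoids : avoids_curve f c).

(* A multiple of the local equation of an effective divisor is a regular
   function, hence lies in the valuation ring of v. *)
Lemma pullback_mult_ge0 (v : K -> int) : closed_point v -> 0 <= pullback_mult f c v.
Proof.
move=> v_point; rewrite /pullback_mult; case: xgetP => [_ -> [u [m [chart m0 mc ->]]]|//].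
have [d d_gt0 [m' m'E]] := common_denominator m.
have pair_m' S : (ray_pairing m' S)%:~R = d%:~R * ray_pairing m S :> rat.
  by rewrite /ray_pairing rmorph_sum mulr_sumr; apply: eq_bigr => i _ /=; apply: m'E.
have [_ sub] := chart => /(_ m').
rewrite closed_point_prod //; last exact: torus_coord_neq0.
move=> H; have : 0 <= \sum_i v (torus_coord f i) * m' i.
  apply: H.
  - apply/eqP; rewrite -(intr_eq0 rat) rmorph_sum /=.
    by under eq_bigr do rewrite m'E; rewrite -mulr_sumr m0 mulr0.
  - move=> S Su; rewrite -(ler0z rat) pair_m' mc //.
    by rewrite mulr_ge0 // ler0z ltW.
  - move=> S Sf; apply/eqP; rewrite -(intr_eq0 rat) pair_m' mc ?(fintype.subsetP sub) //.
    by rewrite c_avoids // mulr0.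
rewrite -(ler0z rat) rmorph_sum /=.
under eq_bigr do rewrite intrM m'E mulrCA.
rewrite -mulr_sumr pmulr_rge0 ?ltr0z //.
by under eq_bigr do rewrite mulrC.
Qed.

Lemma pullback_degree_ge0 : 0 <= pullback_degree f c.
Proof. by apply: fsumr_ge0 => v; apply: pullback_mult_ge0. Qed.

End EffectivePullback.

(** A permutation turns F into initial sets, and two initial sets meet in the smaller one; B is the
    preimage of [initial k]. *)
Lemma chain_vertex n (F : {set proper_subset n}) k : is_cone F -> (k <= n.+1)%N ->
  exists2 B : {set 'I_n.+1}, #|B| = k &
    {in F, forall S, #|val S :&: B| = minn k #|val S|}.
Proof.
move=> cF kn; have [s sP] := chain_straighten cF.
exists (s^-1%g @: initial k) => [|S SF].
  by rewrite card_imset ?card_initial //; apply: perm_inj.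
have -> : s^-1%g @: initial k = s @^-1: initial k.
  by apply/finset.setP => i; rewrite -(permK s i) mem_imset ?inE ?permK //; apply: perm_inj.
rewrite -(card_imset _ (@perm_inj _ s)).
have -> : s @: (val S :&: s @^-1: initial k) = (initial (minn k #|val S|) : {set 'I_n.+1}).
  transitivity (s @: val S :&: initial k).
    apply/finset.setP => i; rewrite -(permKV s i) inE !mem_imset ?inE //; exact: perm_inj.
  rewrite sP //; apply/finset.setP => i; rewrite !inE; lia.
by rewrite card_initial // geq_min kn.
Qed.

Lemma nef_hypersimplex_combination (R : realType) n (a : 'I_n -> rat) :
  (forall i, 0 <= a i) -> nef R (\sum_i a i *: hypersimplex_divisor n i).
Proof.
move=> a_ge0 K f.
have /choice[B BP] (i : 'I_n) : exists B : {set 'I_n.+1}, #|B| = (n.+1 - i.+1)%N /\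
    {in orbit_cone f, forall S, #|val S :&: B| = minn #|B| #|val S|}.
  have [|B Bk BS] := @chain_vertex _ (orbit_cone f) (n.+1 - i.+1) (@orbit_coneP _ _ _ f).
    exact: leq_subr.
  by exists B; split=> //; rewrite Bk.
pose c i (S : proper_subset n) : rat := (minn #|B i| #|val S|)%:R - #|val S :&: B i|%:R.
exists (fun S => \sum_i a i * c i S); split.
- rewrite -divisor_class_sum; apply: eq_bigr => i _; congr (_ *: _).
  by rewrite hypersimplex_divisorE -hypersimplex_class_vertex; case: (BP i) => ->.
- move=> S Sf; rewrite big1 // => i _; have [_ BS] := BP i.
  by rewrite /c BS // subrr mulr0.
- apply: pullback_degree_ge0 => S; last first.
    move=> Sf; rewrite big1 // => i _; have [_ BS] := BP i.
    by rewrite /c BS // subrr mulr0.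
  apply: sumr_ge0 => i _; rewrite mulr_ge0 // subr_ge0 ler_nat leq_min.
  by rewrite !subset_leq_card // ?subsetIl ?subsetIr.
Qed.

(** * Extension of a valuation from a domain to its fraction field *)

Section FractionValuation.

Import FracField.

Variable D : idomainType.

Lemma fraction_quotient (x : {fraction D}) :
  exists a b : D, b != 0 /\ x = tofrac a / tofrac b.
Proof.
pose r : {ratio D} := generic_quotient.repr x.
have b0 : (frac r).2 != 0 := denom_ratioP r.
exists (frac r).1, (frac r).2; split=> //; apply/eqP.
have tb0 : tofrac (frac r).2 != 0 by rewrite tofrac_eq0.
rewrite -(inj_eq (mulIf tb0)) mulfVK // -[x]generic_quotient.reprK -/r; unlock tofrac.
rewrite -[X in X == _]pi_mul /mulf equivf_def !numden_Ratio ?oner_neq0 //.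
  by rewrite !mulr1 mulrC.
all: by rewrite mulr1.
Qed.

Variable w : D -> int.
Hypothesis wM : forall a b : D, a != 0 -> b != 0 -> w (a * b) = w a + w b.
Hypothesis wD : forall a b : D, a != 0 -> b != 0 -> a + b != 0 ->
  Num.min (w a) (w b) <= w (a + b).

(** Computed on a chosen representative; [fraction_valE] gives independence of the choice. The value
    0 at 0 follows the convention of [closed_point]. *)
Definition fraction_val (x : {fraction D}) : int :=
  if x == 0 then 0 else
  w (frac (generic_quotient.repr x)).1 - w (frac (generic_quotient.repr x)).2.

Lemma fraction_valE (a b : D) : a != 0 -> b != 0 -> fraction_val (tofrac a / tofrac b) = w a - w b.
Proof.
move=> a0 b0; rewrite /fraction_val mulf_eq0 invr_eq0 !tofrac_eq0 (negbTE a0) (negbTE b0) /=.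
set x := tofrac a / tofrac b; set r := generic_quotient.repr x.
have r0 : (frac r).2 != 0 := denom_ratioP r.
have xb : x * tofrac b = tofrac a by rewrite mulfVK ?tofrac_eq0.
have eqr : (frac r).1 * b = (frac r).2 * a.
  move: xb; rewrite -[x]generic_quotient.reprK -/r; unlock tofrac.
  rewrite -[X in X = _]pi_mul => /eqP; rewrite /mulf equivf_def.
  by rewrite !numden_Ratio ?oner_neq0 ?mulr1 // => /eqP.
have r10 : (frac r).1 != 0.
  by apply: contraTneq (mulf_neq0 r0 a0) => r10; rewrite -eqr r10 mul0r eqxx.
have := wM r10 b0; rewrite eqr wM // => E.
by apply/eqP; rewrite subr_eq addrAC [w a + _]addrC E addrK.
Qed.

Lemma fraction_val_tofrac (a : D) : a != 0 -> fraction_val (tofrac a) = w a.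
Proof.
move=> a0; have := fraction_valE a0 (oner_neq0 D).
rewrite tofrac1 divr1 => ->.
have /eqP := wM (oner_neq0 D) (oner_neq0 D).
by rewrite mulr1 -subr_eq0 opprD addrA subrr sub0r oppr_eq0 => /eqP->; rewrite subr0.
Qed.

Lemma fraction_nonzero (x : {fraction D}) : x != 0 ->
  exists a b : D, [/\ a != 0, b != 0 & x = tofrac a / tofrac b].
Proof.
have [a [b [b0 ->]]] := fraction_quotient x.
by rewrite mulf_eq0 negb_or tofrac_eq0 => /andP[a0 _]; exists a, b.
Qed.

Lemma fraction_valM x y : x != 0 -> y != 0 ->
  fraction_val (x * y) = fraction_val x + fraction_val y.
Proof.
move=> /fraction_nonzero[a [b [a0 b0 ->]]] /fraction_nonzero[c [d [c0 d0 ->]]].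
rewrite mulf_div -!tofracM !fraction_valE ?mulf_neq0 // !wM //.
by rewrite opprD addrACA.
Qed.

Lemma fraction_valD x y : x != 0 -> y != 0 -> x + y != 0 ->
  Num.min (fraction_val x) (fraction_val y) <= fraction_val (x + y).
Proof.
move=> /fraction_nonzero[a [b [a0 b0 ->]]] /fraction_nonzero[c [d [c0 d0 ->]]].
rewrite addf_div ?tofrac_eq0 // -!tofracM -!tofracD mulf_eq0 negb_or tofrac_eq0.
move=> /andP[s0 _]; rewrite !fraction_valE ?mulf_neq0 //.
have := wD (mulf_neq0 a0 d0) (mulf_neq0 c0 b0) s0; rewrite !wM //.
move: (w a) (w b) (w c) (w d) (w _) => wa wb wc wd ws; lia.
Qed.

End FractionValuation.

(** * Zero and infinity on the projective line *)

Section RationalFunctionField.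

Variable R : realType.

Local Notation C := R[i].
Local Notation K := ({fraction {poly C}}^o : fieldExtType {fraction {poly C}}).

(** The curve is the projective line: its function field is the base field regarded as an extension
    of itself. *)
Definition coordinate : K := tofrac 'X.

Definition order_at0 (p : {poly C}) : int := mup 0 p.
Definition order_at_infinity (p : {poly C}) : int := - (size p).-1%:Z.

Definition point0 : K -> int := fraction_val order_at0.
Definition point_infinity : K -> int := fraction_val order_at_infinity.

Lemma curve_constE (z : C) : curve_const K z = tofrac z%:P.
Proof. exact: mulr1. Qed.

Lemma fraction_val_closed_point (w : {poly C} -> int) :
  (forall a b : {poly C}, a != 0 -> b != 0 -> w (a * b) = w a + w b) ->
  (forall a b : {poly C}, a != 0 -> b != 0 -> a + b != 0 -> Num.min (w a) (w b) <= w (a + b)) ->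
  (forall z, z != 0 -> w z%:P = 0) ->
  (exists2 x, x != 0 & fraction_val w x = 1) ->
  closed_point (fraction_val w : K -> int).
Proof.
move=> wM wD wC w1; split=> //.
- by rewrite /fraction_val eqxx.
- exact: fraction_valM.
- exact: fraction_valD.
- by move=> z z0; rewrite curve_constE fraction_val_tofrac ?polyC_eq0 // wC.
Qed.

Lemma order_at0M (p q : {poly C}) : p != 0 -> q != 0 ->
  order_at0 (p * q) = order_at0 p + order_at0 q.
Proof. by move=> p0 q0; rewrite /order_at0 mupM. Qed.

Lemma order_at_infinityM (p q : {poly C}) : p != 0 -> q != 0 ->
  order_at_infinity (p * q) = order_at_infinity p + order_at_infinity q.
Proof.
move=> p0 q0; rewrite /order_at_infinity size_mul //.
by move: p0 q0; rewrite -!size_poly_gt0; move: (size p) (size q) => a b; lia.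
Qed.

Lemma order_at0X : order_at0 'X = 1.
Proof. by have := mup_XsubCX 1 (0 : C) 0; rewrite eqxx expr1 subr0 /order_at0 => ->. Qed.

Lemma order_at_infinityX : order_at_infinity 'X = -1.
Proof. by rewrite /order_at_infinity size_polyX. Qed.

Lemma point0_coordinate : point0 coordinate = 1.
Proof.
by rewrite /point0 (fraction_val_tofrac order_at0M) ?polyX_eq0 // order_at0X.
Qed.

Lemma point_infinity_coordinate : point_infinity coordinate = -1.
Proof.
rewrite /point_infinity (fraction_val_tofrac order_at_infinityM) ?polyX_eq0 //.
by rewrite order_at_infinityX.
Qed.

Lemma coordinate_neq0 : coordinate != 0.
Proof. by rewrite tofrac_eq0 polyX_eq0. Qed.

Lemma point0_closed : closed_point point0.
Proof.
apply: fraction_val_closed_point.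
- exact: order_at0M.
- move=> p q p0 q0 pq0; rewrite /order_at0.
  have : (minn (mup 0 p) (mup 0 q) <= mup 0 (p + q))%N.
    rewrite mup_geq // dvdp_add // -mup_geq //; first exact: geq_minl.
    exact: geq_minr.
  by lia.
- by move=> z z0; rewrite /order_at0 mupNroot // rootC.
- by exists coordinate; [exact: coordinate_neq0|exact: point0_coordinate].
Qed.

Lemma point_infinity_closed : closed_point point_infinity.
Proof.
apply: fraction_val_closed_point.
- exact: order_at_infinityM.
- move=> p q p0 q0 pq0; rewrite /order_at_infinity.
  by have := size_polyD p q; lia.
- by move=> z z0; rewrite /order_at_infinity size_polyC z0.
- exists (tofrac 1 / tofrac 'X).
    by rewrite mulf_neq0 ?invr_eq0 ?tofrac_eq0 ?oner_eq0 ?polyX_eq0.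
  rewrite (fraction_valE order_at_infinityM) ?oner_neq0 ?polyX_eq0 //.
  by rewrite /order_at_infinity size_polyX size_poly1.
Qed.

(** * Closed points at which the coordinate has a zero or a pole *)

Section Classification.

Variable v : K -> int.
Hypothesis v_point : closed_point v.

Let vM := closed_pointM v_point.

Let vD x y : x != 0 -> y != 0 -> x + y != 0 -> Num.min (v x) (v y) <= v (x + y).
Proof. by case: v_point => _ _ + _ _; apply. Qed.

Let vC (z : C) : z != 0 -> v (tofrac z%:P) = 0.
Proof. by move=> z0; case: v_point => _ _ _ + _ => /(_ z z0); rewrite curve_constE. Qed.

Lemma closed_pointN x : x != 0 -> v (- x) = v x.
Proof.
move=> x0; have n10 : (-1 : C) != 0 by rewrite oppr_eq0 oner_neq0.
rewrite -mulN1r vM ?oppr_eq0 ?oner_neq0 //.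
have -> : -1 = tofrac (-1)%:P :> K by rewrite polyCN tofracN polyC1 tofrac1.
by rewrite vC // add0r.
Qed.

(** A larger value of x + y is excluded by writing x = (x + y) - y. *)
Lemma closed_point_lt x y : x != 0 -> y != 0 -> v x < v y -> x + y != 0 /\ v (x + y) = v x.
Proof.
move=> x0 y0 xy.
have s0 : x + y != 0.
  by apply: contraTneq xy => /eqP; rewrite addr_eq0 => /eqP->; rewrite closed_pointN // ltxx.
split=> //; have := vD x0 y0 s0.
have := vD s0 (_ : - y != 0); rewrite addrK oppr_eq0 closed_pointN // => /(_ y0 x0).
lia.
Qed.

(** By induction on the form p X + c: a nonzero c has value 0 and dominates p X, whose value is
    positive; for c = 0 a factor X splits off. *)
Lemma closed_point_at0 : 0 < v coordinate -> forall p : {poly C}, p != 0 ->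
  v (tofrac p) = order_at0 p * v coordinate.
Proof.
move=> t_gt0; elim/poly_ind => [|p c IH]; first by rewrite eqxx.
have [->|c0] := eqVneq c 0.
  rewrite addr0 mulf_eq0 polyX_eq0 orbF => p0.
  rewrite tofracM vM ?tofrac_eq0 ?polyX_eq0 // IH // order_at0M ?polyX_eq0 //.
  by rewrite order_at0X mulrDl mul1r.
move=> _; rewrite /order_at0 mupNroot; last first.
  by rewrite /root hornerMXaddC mulr0 add0r.
rewrite mul0r; have [->|p0] := eqVneq p 0; first by rewrite mul0r add0r vC.
rewrite addrC tofracD -(vC c0); apply: (proj2 (closed_point_lt _ _ _)).
- by rewrite tofrac_eq0 polyC_eq0.
- by rewrite tofrac_eq0 mulf_neq0 ?polyX_eq0.
- rewrite vC // tofracM vM ?tofrac_eq0 ?polyX_eq0 // IH // /order_at0.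
  by rewrite -[v (tofrac 'X)]/(v coordinate); nia.
Qed.

(** Here p X has negative value for nonzero p and dominates every constant, so the leading term
    decides. *)
Lemma closed_point_at_infinity : v coordinate < 0 -> forall p : {poly C}, p != 0 ->
  v (tofrac p) = order_at_infinity p * - v coordinate.
Proof.
move=> t_lt0; elim/poly_ind => [|p c IH]; first by rewrite eqxx.
have [->|p0] := eqVneq p 0.
  rewrite mul0r add0r polyC_eq0 => c0.
  by rewrite vC // /order_at_infinity size_polyC c0 mul0r.
have pX0 : p * 'X != 0 by rewrite mulf_neq0 ?polyX_eq0.
have vpX : v (tofrac (p * 'X)) = order_at_infinity (p * 'X) * - v coordinate.
  rewrite tofracM vM ?tofrac_eq0 ?polyX_eq0 // IH // order_at_infinityM ?polyX_eq0 //.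
  by rewrite order_at_infinityX mulrDl mulN1r opprK.
have sz : (1 < size (p * 'X)%R)%N by rewrite size_mulX // ltnS size_poly_gt0.
have [->|c0] := eqVneq c 0; first by rewrite addr0.
have -> : order_at_infinity (p * 'X + c%:P) = order_at_infinity (p * 'X).
  by rewrite /order_at_infinity size_polyDl // size_polyC c0.
move=> _; rewrite -vpX tofracD.
apply: (proj2 (closed_point_lt _ _ _)); rewrite ?tofrac_eq0 ?polyC_eq0 //.
rewrite vC // vpX /order_at_infinity; nia.
Qed.

(** [v] is e times the valuation given by [w] and takes the value 1, which forces e = 1. *)
Lemma closed_point_fraction_val (w : {poly C} -> int) (e : int) :
  (forall a b : {poly C}, a != 0 -> b != 0 -> w (a * b) = w a + w b) -> 0 < e ->
  (forall p : {poly C}, p != 0 -> v (tofrac p) = w p * e) -> v = fraction_val w.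
Proof.
move=> wM e_gt0 vw.
have vE x : x != 0 -> v x = fraction_val w x * e.
  move=> /fraction_nonzero[a [b [a0 b0 ->]]].
  rewrite vM ?invr_eq0 ?tofrac_eq0 // closed_pointV ?tofrac_eq0 //.
  by rewrite !vw // fraction_valE // mulrBl.
have e1 : e = 1.
  case: v_point => _ _ _ _ [x x0]; rewrite vE //; move: (fraction_val w x) => z ze1.
  by have : 0 < z; nia.
apply/funext => x; have [->|x0] := eqVneq x 0.
  by rewrite closed_point0 // /fraction_val eqxx.
by rewrite vE // e1 mulr1.
Qed.

Lemma closed_point_gt0 : 0 < v coordinate -> v = point0.
Proof.
move=> t_gt0; apply: (closed_point_fraction_val order_at0M t_gt0).
exact: closed_point_at0.
Qed.

Lemma closed_point_lt0 : v coordinate < 0 -> v = point_infinity.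
Proof.
move=> t_lt0; apply: (@closed_point_fraction_val _ (- v coordinate) order_at_infinityM).
  by rewrite oppr_gt0.
exact: closed_point_at_infinity.
Qed.

End Classification.

End RationalFunctionField.

(** * The punctured flag and its torus-invariant curve *)

Section FlagCurve.

Variables (R : realType) (n p : nat).
Hypothesis p_lt : (p < n)%N.

Local Notation subsets := (proper_subset n).
Local Notation K := ({fraction {poly R[i]}}^o : fieldExtType {fraction {poly R[i]}}).
Local Notation t := (coordinate R).

Let e0 : 'I_n.+1 := inord p.
Let e1 : 'I_n.+1 := inord p.+1.

Let e0E : e0 = p :> nat. Proof. by rewrite inordK // ltnS ltnW. Qed.
Let e1E : e1 = p.+1 :> nat. Proof. by rewrite inordK. Qed.

Let e01 : e0 != e1. Proof. by rewrite -val_eqE /= e0E e1E; lia. Qed.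

Lemma proper_initial k : (0 < k <= n)%N -> (0 < #|@initial n k| < n.+1)%N.
Proof. by move=> ?; rewrite card_initial; lia. Qed.

Lemma initial_swapE : initial_swap n p = e1 |: initial p.
Proof. by apply/finset.setP => i; rewrite !inE orbC -val_eqE /= e1E. Qed.

Lemma initialS : initial p.+1 = e0 |: initial p.
Proof. by apply/finset.setP => i; rewrite !inE -val_eqE /= e0E ltnS leq_eqVlt. Qed.

Lemma initialSS : initial p.+2 = e1 |: (e0 |: initial p).
Proof.
apply/finset.setP => i; rewrite !inE -!val_eqE /= e0E e1E; lia.
Qed.

Lemma proper_swap : (0 < #|initial_swap n p| < n.+1)%N.
Proof. by rewrite initial_swapE cardsU1 card_initial ?inE ?e1E; lia. Qed.

Definition flag_step : subsets :=
  exist _ (initial p.+1) (@proper_initial p.+1 p_lt).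
Definition flag_swap : subsets := exist _ (initial_swap n p) proper_swap.

(** The n - 1 remaining rays span a cone of codimension one, so its orbit closure is a curve. *)
Definition punctured_flag : {set subsets} :=
  [set S : subsets | (val S == initial #|val S|) && (#|val S| != p.+1)]%SET.

Lemma initial_subset k l : (k <= l)%N -> initial k \subset (initial l : {set 'I_n.+1}).
Proof. by move=> kl; apply/fintype.subsetP => i; rewrite !inE => /leq_trans; apply. Qed.

Lemma punctured_flagP S : reflect (exists2 k, k != p.+1 & val S = initial k)
  (S \in punctured_flag).
Proof.
rewrite inE; apply: (iffP andP) => [[/eqP E kp]|[k kp E]].
  by exists #|val S|.
have : (k <= n)%N.
  rewrite leqNgt; apply/negP => nk; have /andP[_] := valP S; rewrite E.
  by rewrite ltnNge -[X in (X <= _)%N]card_ord -cardsT subset_leq_card //;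
    apply/fintype.subsetP => i _; rewrite inE (leq_trans (ltn_ord i)).
by move=> kn; rewrite E card_initial ?eqxx // leqW.
Qed.

Lemma punctured_flag_cone : is_cone punctured_flag.
Proof.
move=> S T /punctured_flagP[k _ Sk] /punctured_flagP[l _ Tl].
rewrite /comparable_subsets Sk Tl.
by case/orP: (leq_total k l) => /initial_subset ->; rewrite ?orbT.
Qed.

Lemma initial_punctured k : (0 < k <= n)%N -> k != p.+1 ->
  exists2 S, S \in punctured_flag & val S = initial k.
Proof.
move=> k_n kp; exists (exist _ (initial k) (proper_initial k_n)) => //.
by apply/punctured_flagP; exists k.
Qed.

(** [initial p] contains neither [e0] nor [e1] and [initial p.+2] contains both, so a set with
    exactly one of them cannot be comparable to these in the other direction. *)
Lemma comparable_flag (S : subsets) : {in punctured_flag, forall T, comparable_subsets S T} ->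
  (e0 \in val S) != (e1 \in val S) ->
  initial p \subset val S /\ val S \subset (initial p.+2 : {set 'I_n.+1}).
Proof.
move=> cS e01S; split.
  have [p0|p_gt0] := posnP p.
    by apply/fintype.subsetP => i; rewrite inE p0.
  have [||T /cS/orP[]] := @initial_punctured p; try lia; last by move=> ? <-.
  move=> /fintype.subsetP ST TE; move: (ST e0) (ST e1); rewrite TE !inE e0E e1E.
  by move: e01S; case: (e0 \in _); case: (e1 \in _) => //; lia.
have [p2|p2] := ltnP p.+1 n; last first.
  by apply/fintype.subsetP => i _; rewrite inE (leq_trans (ltn_ord i)).
have [||T /cS/orP[]] := @initial_punctured p.+2; try lia; first by move=> ? <-.
move=> /fintype.subsetP TS TE; move: (TS e0) (TS e1); rewrite TE !inE e0E e1E.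
by rewrite !ltnS leqnn leqnSn; move: e01S => /[swap] /(_ isT) -> /[swap] /(_ isT) ->.
Qed.

Lemma comparable_flag_step (S : subsets) :
  {in punctured_flag, forall T, comparable_subsets S T} ->
  e0 \in val S -> e1 \notin val S -> S = flag_step.
Proof.
move=> cS S0 S1; have [|lo hi] := comparable_flag cS; first by rewrite S0 (negbTE S1).
apply/val_inj/eqP; rewrite /= initialS finset.eqEsubset finset.subUset finset.sub1set S0 lo !andbT.
apply/fintype.subsetP => i iS; have := fintype.subsetP hi i iS.
rewrite initialSS in_setU1 => /orP[/eqP ei|//].
by rewrite ei (negbTE S1) in iS.
Qed.

Lemma comparable_flag_swap (S : subsets) :
  {in punctured_flag, forall T, comparable_subsets S T} ->
  e1 \in val S -> e0 \notin val S -> S = flag_swap.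
Proof.
move=> cS S1 S0; have [|lo hi] := comparable_flag cS; first by rewrite S1 (negbTE S0).
apply/val_inj/eqP; rewrite /= initial_swapE finset.eqEsubset finset.subUset finset.sub1set S1 lo !andbT.
apply/fintype.subsetP => i iS; have := fintype.subsetP hi i iS.
rewrite initialSS finset.setUCA in_setU1 => /orP[/eqP ei|//].
by rewrite ei (negbTE S0) in iS.
Qed.

Section Pairing.

Variables (V : zmodType) (m : 'I_n.+1 -> V).
Hypothesis m_sum0 : \sum_i m i = 0.
Hypothesis m_flag : {in punctured_flag, forall S, ray_pairing m S = 0}.

Lemma sum_initial k : (k <= n.+1)%N -> k != p.+1 -> \sum_(i in initial k) m i = 0.
Proof.
move=> kn kp; have [->|k_gt0] := posnP k.
  by rewrite big_pred0 // => i; rewrite inE.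
move: kn; rewrite leq_eqVlt => /orP[/eqP->|kn].
  by rewrite -[RHS]m_sum0; apply: eq_bigl => i; rewrite inE ltn_ord.
have [|S Sf SE] := @initial_punctured k _ kp; first by rewrite k_gt0.
by rewrite -SE; apply: m_flag.
Qed.

Lemma ray_pairing_step : ray_pairing m flag_step = m e0.
Proof.
rewrite /ray_pairing /= initialS big_setU1 ?inE ?e0E ?ltnn //=.
by rewrite sum_initial ?addr0 //; lia.
Qed.

(** The vanishing sums over [initial p] and [initial p.+2] give m e0 + m e1 = 0. *)
Lemma ray_pairing_swap : ray_pairing m flag_swap = - m e0.
Proof.
have := @sum_initial p.+2; rewrite initialSS big_setU1 /=; last first.
  by rewrite !inE e1E eq_sym (negbTE e01); lia.
rewrite big_setU1 ?inE ?e0E ?ltnn //= sum_initial ?addr0; try lia.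
rewrite /ray_pairing /= initial_swapE big_setU1 ?inE ?e1E /=; try lia.
rewrite sum_initial ?addr0; try lia.
by move=> H; apply/eqP; rewrite -addr_eq0 H ?eqxx //; lia.
Qed.

End Pairing.

(** These characters vanish on the punctured flag. The coefficient is in any abelian group, to serve
    for integral characters and for rational local equations. *)
Definition flag_character (V : zmodType) (x : V) (i : 'I_n.+1) : V :=
  if i == e0 then x else if i == e1 then - x else 0.

Lemma flag_character_e0 (V : zmodType) (x : V) : flag_character x e0 = x.
Proof. by rewrite /flag_character eqxx. Qed.

Lemma flag_character_pairing (V : zmodType) (x : V) (S : subsets) :
  ray_pairing (flag_character x) S
  = (if e0 \in val S then x else 0) - (if e1 \in val S then x else 0).
Proof.
have sumE (e : 'I_n.+1) y : \sum_(i in val S) (if i == e then y else 0)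
    = if e \in val S then y else 0 :> V.
  rewrite -big_mkcondr /=; case: ifP => eS; last first.
    by rewrite big1 // => i /andP[iS /eqP ie]; rewrite ie eS in iS.
  by rewrite (big_pred1 e) // => i /=; have [->|] := eqVneq i e; rewrite ?eS ?andbF.
transitivity (\sum_(i in val S) ((if i == e0 then x else 0) + (if i == e1 then - x else 0))).
  apply: eq_bigr => i _; rewrite /flag_character.
  by have [->|] := eqVneq i e0; rewrite ?(negbTE e01) ?addr0 ?add0r.
by rewrite big_split /= !sumE; congr (_ + _); case: ifP; rewrite ?oppr0.
Qed.

Lemma flag_character_sum (V : zmodType) (x : V) : \sum_i flag_character x i = 0.
Proof.
rewrite (bigD1 e0) //= (bigD1 e1) 1?eq_sym //= /flag_character eqxx eq_sym.
rewrite (negbTE e01) eqxx addrA subrr add0r big1 // => i /andP[/negbTE-> /negbTE->] //.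
Qed.

Lemma flag_character_flag (V : zmodType) (x : V) :
  {in punctured_flag, forall S, ray_pairing (flag_character x) S = 0}.
Proof.
move=> S /punctured_flagP[k kp Sk].
rewrite flag_character_pairing Sk !inE e0E e1E.
suff -> : (p < k)%N = (p.+1 < k)%N by rewrite subrr.
lia.
Qed.

(** A character m pulls back to the power m e0 of t. *)
Definition flag_torus_coord (i : 'I_n.+1) : K := if i == e0 then t else 1.

Lemma flag_torus_coord_neq0 i : flag_torus_coord i != 0.
Proof. by rewrite /flag_torus_coord; case: ifP; rewrite ?coordinate_neq0 ?oner_neq0. Qed.

Definition flag_curve : curve_map n K :=
  CurveMap punctured_flag_cone flag_torus_coord_neq0.

Lemma sum_flag_valuation (A : pzRingType) (v : K -> int) (m : 'I_n.+1 -> A) :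
  closed_point v ->
  \sum_i m i * (v (flag_torus_coord i))%:~R = m e0 * (v t)%:~R.
Proof.
move=> v_point; rewrite (bigD1 e0) //= big1 ?addr0 => [|i /negbTE ie].
  by rewrite /flag_torus_coord eqxx.
by rewrite /flag_torus_coord ie (closed_point1 v_point) mulr0.
Qed.

Lemma flag_monomial_val (v : K -> int) (m : 'I_n.+1 -> int) : closed_point v ->
  v (\prod_i flag_torus_coord i ^ m i) = m e0 * v t.
Proof.
move=> v_point; rewrite closed_point_prod //; last exact: flag_torus_coord_neq0.
under eq_bigr do rewrite mulrC -[v _]intz.
by rewrite sum_flag_valuation // intz.
Qed.

Lemma chart_comparable (v : K -> int) u S : maps_into_chart flag_curve v u -> S \in u ->
  {in punctured_flag, forall T, comparable_subsets S T}.
Proof. by case=> cu /fintype.subsetP sub _ Su T /sub; apply: cu. Qed.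

(** Among the sets comparable to the flag, minus the flag character is negative on [flag_step]
    alone. Without [flag_step] in u it would be regular on the chart, but it pulls back to the
    inverse of t, which has a pole at v. *)
Lemma chart_step (v : K -> int) u : closed_point v -> 0 < v t ->
  maps_into_chart flag_curve v u -> flag_step \in u.
Proof.
move=> v_point vt chart; apply: contraT => stepu.
have [_ _ /(_ (flag_character (- 1)))] := chart.
rewrite flag_monomial_val // flag_character_e0 mulN1r oppr_ge0 leNgt vt.
apply; [exact: flag_character_sum| |exact: flag_character_flag].
move=> S Su; rewrite flag_character_pairing.
case: ifP => S0; case: ifP => S1 //.
suff SE : S = flag_step by rewrite -SE Su in stepu.
by apply: comparable_flag_step => //; [exact: chart_comparable chart Su|rewrite S1].
Qed.

Lemma chart_swap (v : K -> int) u : closed_point v -> v t < 0 ->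
  maps_into_chart flag_curve v u -> flag_swap \in u.
Proof.
move=> v_point vt chart; apply: contraT => swapu.
have [_ _ /(_ (flag_character 1))] := chart.
rewrite flag_monomial_val // flag_character_e0 mul1r leNgt vt.
apply; [exact: flag_character_sum| |exact: flag_character_flag].
move=> S Su; rewrite flag_character_pairing.
case: ifP => S0; case: ifP => S1 //.
suff SE : S = flag_swap by rewrite -SE Su in swapu.
by apply: comparable_flag_swap => //; [exact: chart_comparable chart Su|rewrite S0].
Qed.

Lemma flag_extension_cone S :
  {in punctured_flag, forall T, comparable_subsets S T} -> is_cone (S |: punctured_flag).
Proof.
move=> cS T U /setU1P[->|Tf] /setU1P[->|Uf].
- by rewrite /comparable_subsets subxx.
- exact: cS.
- by rewrite comparable_subsetsC cS.
- exact: punctured_flag_cone.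
Qed.

Lemma comparable_initial (S : subsets) :
  (forall k, k != p.+1 -> (initial k \subset val S) || (val S \subset initial k)) ->
  {in punctured_flag, forall T, comparable_subsets S T}.
Proof.
by move=> cS T /punctured_flagP[k kp Tk]; rewrite /comparable_subsets Tk orbC; apply: cS.
Qed.

Lemma flag_step_comparable : {in punctured_flag, forall T, comparable_subsets flag_step T}.
Proof.
apply: comparable_initial => k _ /=.
by case/orP: (leq_total k p.+1) => /initial_subset ->; rewrite ?orbT.
Qed.

Lemma flag_swap_comparable : {in punctured_flag, forall T, comparable_subsets flag_swap T}.
Proof.
apply: comparable_initial => k kp /=; have [kp'|pk] := leqP k p.
  by apply/orP; left; apply/fintype.subsetP => i; rewrite !inE => ik; rewrite (leq_trans ik).
by apply/orP; right; apply/fintype.subsetP => i; rewrite !inE; lia.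
Qed.

(** * Degree of a divisor on the flag curve *)

Variable c : subsets -> rat.
Hypothesis c_avoids : avoids_curve flag_curve c.

(** Every chart at v contains [flag_step], so a local equation has m e0 = c flag_step and the
    multiplicity is unique; the flag character with this coefficient attains it. *)
Lemma pullback_mult_step (v : K -> int) : closed_point v -> 0 < v t ->
  pullback_mult flag_curve c v = c flag_step * (v t)%:~R.
Proof.
move=> v_point vt; apply: xget_unique => [|q [u [m [chart m0 mc ->]]]]; last first.
  rewrite sum_flag_valuation // -(mc _ (chart_step v_point vt chart)).
  rewrite ray_pairing_step // => S Sf; rewrite mc ?c_avoids //.
  by have [_ /fintype.subsetP sub _] := chart; apply: sub.
exists (flag_step |: punctured_flag), (flag_character (c flag_step)); split.
- split; [exact: flag_extension_cone flag_step_comparable|exact: subsetU1|].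
  move=> m m0 m_ge0 m_flag; rewrite flag_monomial_val //.
  by rewrite -ray_pairing_step // mulr_ge0 ?m_ge0 ?setU11 // ltW.
- exact: flag_character_sum.
- move=> S /setU1P[->|Sf]; last by rewrite flag_character_flag ?c_avoids.
  rewrite ray_pairing_step; first by rewrite flag_character_e0.
    exact: flag_character_sum.
  exact: flag_character_flag.
- by rewrite sum_flag_valuation // flag_character_e0.
Qed.

Lemma pullback_mult_swap (v : K -> int) : closed_point v -> v t < 0 ->
  pullback_mult flag_curve c v = - c flag_swap * (v t)%:~R.
Proof.
move=> v_point vt; apply: xget_unique => [|q [u [m [chart m0 mc ->]]]]; last first.
  rewrite sum_flag_valuation // -(mc _ (chart_swap v_point vt chart)).
  rewrite ray_pairing_swap ?opprK // => S Sf; rewrite mc ?c_avoids //.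
  by have [_ /fintype.subsetP sub _] := chart; apply: sub.
exists (flag_swap |: punctured_flag), (flag_character (- c flag_swap)); split.
- split; [exact: flag_extension_cone flag_swap_comparable|exact: subsetU1|].
  move=> m m0 m_ge0 m_flag; rewrite flag_monomial_val // -[m e0]opprK.
  by rewrite -ray_pairing_swap // mulNr -mulrN mulr_ge0 ?m_ge0 ?setU11 // oppr_ge0 ltW.
- exact: flag_character_sum.
- move=> S /setU1P[->|Sf]; last by rewrite flag_character_flag ?c_avoids.
  rewrite ray_pairing_swap; first by rewrite flag_character_e0 opprK.
    exact: flag_character_sum.
  exact: flag_character_flag.
- by rewrite sum_flag_valuation // flag_character_e0.
Qed.

(** Every local equation gives m e0 times 0, and the default value of [xget] is 0 as well. *)
Lemma pullback_mult_away (v : K -> int) : closed_point v -> v t = 0 ->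
  pullback_mult flag_curve c v = 0.
Proof.
move=> v_point vt; rewrite /pullback_mult; case: xgetP => [_ -> [u [m [_ _ _ ->]]]|//].
by rewrite sum_flag_valuation // vt mulr0.
Qed.

(** Only zero and infinity contribute; the values 1 and -1 of t there yield one coefficient each. *)
Lemma pullback_degree_flag_curve :
  pullback_degree flag_curve c = c flag_step + c flag_swap.
Proof.
pose s := [:: @point0 R; @point_infinity R].
have t0 := point0_coordinate R; have ti := point_infinity_coordinate R.
have s_uniq : uniq s.
  rewrite /= inE andbT; apply/eqP => E; move: t0; rewrite E ti; lia.
transitivity (\sum_(v <- s) pullback_mult flag_curve c v).
  rewrite (fsbig_seq _ _ s_uniq); apply/esym/fsbig_widen => v /=.
    by rewrite !inE => /orP[/eqP->|/eqP->]; [exact: point0_closed|exact: point_infinity_closed].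
  move=> [v_point vs]; apply: pullback_mult_away => //.
  apply/eqP; apply: contra_notT vs; rewrite neq_lt => /orP[lt0|gt0] /=.
    by rewrite (closed_point_lt0 v_point lt0) !inE eqxx orbT.
  by rewrite (closed_point_gt0 v_point gt0) !inE eqxx.
rewrite /s big_cons big_seq1 pullback_mult_step ?t0 //; last exact: point0_closed.
rewrite pullback_mult_swap ?ti //; last exact: point_infinity_closed.
by rewrite mulr1 mulrN1 opprK.
Qed.

(** [initial p] and [initial p.+2] belong to the punctured flag, where c is 0, or are empty or full,
    where the value is 0 by convention. *)
Lemma flag_curve_degree_avoids :
  flag_curve_degree p c = c flag_step + c flag_swap.
Proof.
have value0 k : k != p.+1 -> subset_value c (initial k) = 0.
  move=> kp; rewrite /subset_value; case: insubP => //= S _ SE.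
  by apply: c_avoids; apply/punctured_flagP; exists k.
rewrite /flag_curve_degree (value0 p) 1?(value0 p.+2); try lia.
by rewrite !subr0 -(subset_value_val c flag_step) -(subset_value_val c flag_swap).
Qed.

End FlagCurve.

Theorem proposition1p1 (R : realType) (n : nat) (n_gt0 : (0 < n)%N) :
  subalgebra_span (range (hypersimplex_divisor n)) = chow_invariants n /\
  conical_span (hypersimplex_divisor n)
    = nef_cone R n `&` (Pic n `&` chow_invariants n).
Proof.
split; first exact: subalgebra_hypersimplex.
apply/seteqP; split=> [_ [a [a_ge0 ->]]|u [[Pic_u nef_u] [_ inv_u]]].
  have PicL : Pic n (\sum_i a i *: hypersimplex_divisor n i).
    by rewrite divisor_class_sum; eexists.
  split; first by split=> //; apply: nef_hypersimplex_combination.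
  split=> // s; rewrite rmorph_sum; apply: eq_bigr => i _ /=.
  by rewrite chow_actZ chow_act_hypersimplex.
have [a uE] := invariant_divisor_combination Pic_u inv_u.
exists a; split=> // i.
(* The ordinal i stands for the class with k = n - i; the curve meeting it has p + 1 = k, that is p
   = [rev_ord i]. *)
have p_lt : (rev_ord i < n)%N by exact: ltn_ord.
have [c [uc c_avoids]] := nef_u _ (flag_curve R n (rev_ord i)).
rewrite (pullback_degree_flag_curve p_lt) // -(flag_curve_degree_avoids p_lt c_avoids).
(* The divisor c supplied by nefness has the class of the combination of the L_i, hence the same
   degree, which is a i. *)
rewrite (@flag_curve_degree_class _ _ c (fun S => \sum_j a j * hypersimplex_coef j.+1 S)).
  rewrite flag_curve_degree_sum (bigD1 i) //= big1 ?addr0 => [|j ji].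
    rewrite flag_curve_degree_hypersimplex //=; last by have := ltn_ord i; lia.
    have -> : (n.+1 - i.+1 == (n - i.+1).+1)%N by have := ltn_ord i; lia.
    by rewrite mulr1.
  rewrite flag_curve_degree_hypersimplex //=; last by have := ltn_ord j; lia.
  have /negbTE-> : (n.+1 - j.+1 != (n - i.+1).+1)%N.
    by move: ji; rewrite -val_eqE /=; have := ltn_ord i; have := ltn_ord j; lia.
  by rewrite mulr0.
by rewrite -uc uE divisor_class_sum.
Qed.
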